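(* Let $\mathbb{P}$ be a solution of the martingale problem for $\mathcal{A}$, let $h\in C_c^2(E)$, $H := e^h - 1$, and $D_t := e^{h(X_t)-h(X_0)}\exp\big(-\int_0^t \frac{\mathcal{A}H(X_s)}{e^{h(X_s)}}ds\big)$. Let $\mathbb{Q}$ be a probability measure on $(\Omega,\mathcal{F}^X)$ such that $\mathbb{Q}[A] = \mathbb{E}_{\mathbb{P}}[D_t\mathbb{1}_A]$ for all $A\in\mathcal{F}_{t+}^X$ and all $t\ge0$. Then $\mathbb{Q}$ is a solution of the martingale problem for the operator $\tilde{\mathcal{A}}: C_c^2(E)\to B(E)$ given by $\tilde{\mathcal{A}}f := \mathcal{A}f + \frac{\Gamma(H,f)}{e^h}$, and this operator equals $\tilde{\mathcal{A}}f(x) = \frac12\sum_{i,j}\alpha_{ij}(x)\partial_{ij}f(x)+\sum_i\tilde\beta_i(x)\partial_if(x)-\tilde\gamma(x)f(x)+\int_{\mathbb{R}^d}(f(x+\xi)-f(x)-\langle\nabla f(x),\chi(\xi)\rangle)\tilde\mu(x,d\xi)$ with $\tilde\beta(x) = \beta(x)+\alpha(x)\nabla h(x)+\int(e^{h(x+\xi)-h(x)}-1)\chi(\xi)\mu(x,d\xi)$, $\tilde\gamma(x) = e^{-h(x)}\gamma(x)$, $\tilde\mu(x,d\xi) = e^{h(x+\xi)-h(x)}\mu(x,d\xi)$.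
   Context: $E$ is a closed subset of $\mathbb{R}^d$, $E_\Delta = E\cup\{\Delta\}$ its one-point compactification; every measurable function $f$ on $E$ is extended by $f(\Delta):=0$. $\Omega$ is the space of càdlàg $\omega:\mathbb{R}_+\to E_\Delta$ such that $\omega(t-)=\Delta$ or $\omega(t)=\Delta$ implies $\omega(s)=\Delta$ for $s\ge t$; $X_t(\omega)=\omega(t)$, $\mathcal{F}^X=\sigma(X_s:s\ge0)$, $\mathcal{F}_t^X=\sigma(X_s:s\le t)$. $B(E)$ denotes bounded measurable functions on $E$. Fix a bounded continuous $\chi:\mathbb{R}^d\to\mathbb{R}^d$ with $\chi(\xi)=\xi$ near $0$. Let $\alpha,\beta,\gamma$ be measurable maps on $E$ with values in positive semidefinite symmetric $d\times d$ matrices, $\mathbb{R}^d$, $\mathbb{R}_+$, and $\mu$ a transition kernel from $E$ to $\mathbb{R}^d$, such that $\alpha,\beta,\gamma$ and $\int(\|\xi\|^2\wedge1)\mu(\cdot,d\xi)$ are bounded on compact subsets of $E$. For $f\in C_c^2(E)$, $\mathcal{A}f(x)=\frac12\sum_{i,j}\alpha_{ij}(x)\partial_{ij}f(x)+\sum_i\beta_i(x)\partial_if(x)-\gamma(x)f(x)+\int_{\mathbb{R}^d}(f(x+\xi)-f(x)-\langle\nabla f(x),\chi(\xi)\rangle)\mu(x,d\xi)$. For an operator $\mathcal{B}:C_c^2(E)\to B(E)$, a probability measure $\mathbb{P}$ on $(\Omega,\mathcal{F}^X)$ solves the martingale problem for $\mathcal{B}$ if for every $f\in C_c^2(E)$,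 $f(X_t)-f(X_0)-\int_0^t\mathcal{B}f(X_s)ds$ is a $\mathbb{P}$-martingale w.r.t. $(\mathcal{F}_t^X)$. The carré-du-champ operator is $\Gamma(f,g) := \mathcal{A}(fg)-f\mathcal{A}g-g\mathcal{A}f$ for $f,g\in C_c^2(E)$. (Such a $\mathbb{Q}$ exists; $D$ is a strictly positive $((\mathcal{F}_{t+}^X),\mathbb{P})$-martingale.) *)

(* Defs.v *)
From HB Require Import structures.
From mathcomp Require Import all_boot all_order all_algebra.
From mathcomp Require Import all_classical all_reals all_analysis measurable_realfun.
Unset Printing Implicit Defensive.
Import Order.TTheory GRing.Theory Num.Theory.
Import numFieldNormedType.Exports.
Local Open Scope classical_set_scope.
Local Open Scope ring_scope.

Section Defs.
Variables (R : realType) (d : nat).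
Local Notation V := 'rV[R]_d.

Definition Rd : measurableType _ := g_sigma_algebraType (@open V).

(** Neighbourhood base of the one-point compactification E_Delta of a closed
    E subset R^d (None = Delta): [close l y e] means "y lies in the e-neighbourhood
    of l": a ball of radius e around l if l in E, and {Delta} union
    {z : |z| > 1/e} if l = Delta (complement of a compact of E). *)
Definition close (l y : option V) (e : R) : Prop :=
  match l, y with
  | Some x, Some z => `|z - x| < e
  | Some _, None => False
  | None, None => True
  | None, Some z => e^-1 < `|z|
  end.

(** Cadlag paths R_+ -> E_Delta with absorbing cemetery.  The path is
    represented on all of R, normalised by w s = w 0 for s < 0. *)
Definition is_path (E : set V) (w : R -> option V) : Prop :=
  [/\ (forall s, s < 0 -> w s = w 0),
      (forall s x, w s = Some x -> E x),
      (forall t, 0 <= t -> forall e, 0 < e -> exists2 del, 0 < del &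
          forall s, t <= s < t + del -> close (w t) (w s) e),
      (forall t, 0 < t -> exists l, forall e, 0 < e -> exists2 del, 0 < del &
          forall s, t - del < s < t -> close l (w s) e)
    & (forall t, 0 <= t ->
         (w t = None \/ (0 < t /\ forall e, 0 < e -> exists2 del, 0 < del &
            forall s, t - del < s < t -> close None (w s) e)) ->
         forall s, t <= s -> w s = None)].

Record path (E : set V) := Path { pval :> R -> option V ; pvalP : is_path E pval }.
Arguments Path {E}.
Arguments pval {E}.

Lemma none_is_path (E : set V) : is_path E (fun _ => None).
Proof.
split => //.
- by move=> t _ e e0; exists 1.
- by move=> t _; exists None => e e0; exists 1.
Qed.

HB.instance Definition _ (E : set V) := gen_eqMixin (path E).
HB.instance Definition _ (E : set V) := gen_choiceMixin (path E).
HB.instance Definition _ (E : set V) :=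
  isPointed.Build (path E) (Path (fun _ => None) (none_is_path E)).

(** Generators of sigma(X_s : s in I): preimages under X_s of {Delta} and of
    (traces on E of) open subsets of R^d; these generate the Borel sets of E_Delta. *)
Definition coord_gen (E : set V) (I : set R) : set (set (path E)) :=
  [set A | exists s, I s /\
     (A = [set w | pval w s = None] \/
      exists U : set V, open U /\ A = [set w | exists2 x, pval w s = Some x & U x])].

Definition Omega (E : set V) : measurableType _ :=
  g_sigma_algebraType (coord_gen E [set s | 0 <= s]).

Definition Ft (E : set V) (t : R) : set (set (path E)) :=
  <<s coord_gen E [set s | 0 <= s <= t] >>.
Definition Ftplus (E : set V) (t : R) : set (set (path E)) :=
  fun A => forall u, t < u -> Ft E u A.

Definition ext (g : V -> R) (o : option V) : R :=
  if o is Some x then g x else 0.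

Definition evec (i : 'I_d) : V := delta_mx 0 i.
Definition pd (i : 'I_d) (f : V -> R) : V -> R := fun x => 'D_(evec i) f x.

Definition C2c (f : V -> R) : Prop :=
  [/\ continuous f,
      (forall i x, derivable f x (evec i)),
      compact (closure [set x | f x != 0])
    & [/\ (forall i, continuous (pd i f)),
          (forall i j x, derivable (pd j f) x (evec i))
        & (forall i j, continuous (pd i (pd j f)))]].

Definition bmeas (E : set V) (g : V -> R) : Prop :=
  @measurable_fun _ _ Rd R (E : set Rd) (g : Rd -> R) /\
  exists M : R, forall x, E x -> `|g x| <= M.

Definition sqn (v : V) : R := \sum_i v 0 i ^+ 2.

Definition levy_data (E : set V) (alpha : V -> 'M[R]_d) (beta : V -> V)
    (gamma : V -> R) (mu : V -> {measure set Rd -> \bar R}) (chi : V -> V) : Prop :=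
  [/\ closed E,
      [/\ continuous chi, (exists M : R, forall xi, `|chi xi| <= M)
        & \forall xi \near (0 : V), chi xi = xi],
      (forall x, E x -> [/\ (alpha x)^T = alpha x,
                        (forall v : V, 0 <= (v *m alpha x *m v^T) 0 0)
                      & 0 <= gamma x]),
      [/\ (forall i j, @measurable_fun _ _ Rd R (E : set Rd) (fun x : Rd => alpha x i j)),
          (forall i, @measurable_fun _ _ Rd R (E : set Rd) (fun x : Rd => beta x 0 i)),
          @measurable_fun _ _ Rd R (E : set Rd) (gamma : Rd -> R)
        & (forall B : set Rd, measurable B ->
             measurable_fun (E : set Rd) (fun x : Rd => mu x B))]
    & (forall K : set V, compact K -> K `<=` E -> exists M : R, forall x, K x ->
         [/\ (forall i j, `|alpha x i j| <= M), (forall i, `|beta x 0 i| <= M),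
             gamma x <= M
           & (\int[mu x]_xi (Num.min (sqn (xi : V)) 1)%:E <= M%:E)%E])].

Definition Aop (alpha : V -> 'M[R]_d) (beta : V -> V) (gamma : V -> R)
    (mu : V -> {measure set Rd -> \bar R}) (chi : V -> V) (f : V -> R) : V -> R :=
  fun x => 2^-1 * (\sum_i \sum_j alpha x i j * pd i (pd j f) x)
         + \sum_i beta x 0 i * pd i f x - gamma x * f x
         + Rintegral (mu x) setT
             (fun xi : Rd => f (x + (xi : V)) - f x - \sum_i pd i f x * chi xi 0 i).

Definition Gamma (A : (V -> R) -> V -> R) (f g : V -> R) : V -> R :=
  fun x => A (f \* g) x - f x * A g x - g x * A f x.

Definition martingale (E : set V) (P : probability (Omega E) R)
    (M : R -> Omega E -> R) : Prop :=
  (forall t, 0 <= t ->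
     (forall B : set R, measurable B -> Ft E t (M t @^-1` B)) /\
     P.-integrable setT (fun w => (M t w)%:E)) /\
  (forall s t, 0 <= s <= t -> forall A : set (Omega E), Ft E s A ->
     (\int[P]_(w in A) (M t w)%:E = \int[P]_(w in A) (M s w)%:E)%E).

Definition mp_process (E : set V) (B : (V -> R) -> V -> R) (f : V -> R)
    (t : R) (w : Omega E) : R :=
  ext f (pval w t) - ext f (pval w 0)
  - Rintegral (@lebesgue_measure R) `[0, t] (fun s => ext (B f) (pval w s)).

Definition solves_mp (E : set V) (P : probability (Omega E) R)
    (B : (V -> R) -> V -> R) : Prop :=
  forall f, C2c f -> martingale E P (mp_process E B f).

End Defs.

Arguments close {R d}.
Arguments is_path {R d}.
Arguments path {R d}.
Arguments Path {R d E}.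
Arguments pval {R d E}.
Arguments coord_gen {R d}.
Arguments Omega {R d}.
Arguments Ft {R d}.
Arguments Ftplus {R d}.
Arguments ext {R d}.
Arguments evec {R d}.
Arguments pd {R d}.
Arguments C2c {R d}.
Arguments bmeas {R d}.
Arguments sqn {R d}.
Arguments levy_data {R d}.
Arguments Aop {R d}.
Arguments Gamma {R d}.
Arguments martingale {R d}.
Arguments mp_process {R d}.
Arguments solves_mp {R d}.

(* Main.v *)
(** The Girsanov-type statement is proved without stochastic calculus.  Put
    [F = e^h f = f + Hf], [c = AH / e^h] and [g = At f], so that
    [Af + A(Hf) = c F + e^h g].  For [B] in [F_s] the function
    [phi(r) = E_Q[1_B M_r]], [M] the candidate martingale, satisfies
    [|phi(b) - phi(a)| <= C (b - a)^2] on [s, t], hence is constant there.  To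
    see this, write the increment under [P] with the densities [D_b] and [D_a], expand
    [exp(- int_a^b c)] to first order and use the [P]-martingales of [f], [Hf]:
    what remains are the integrals of [c_r (F_r - F_b)] and [g_r (H_r - H_b)] over [a, b].
    Conditioning on time [r] before integrating, each increment is O(b - a) in expectation
    by the martingale property again.
    The explicit form of [At] is the product rule for the derivatives together with the
    second-order Taylor estimate that makes the jump integrals converge. *)
Require Import Defs.
From HB Require Import structures.
From mathcomp Require Import all_boot all_order all_algebra.
From mathcomp Require Import all_classical all_reals all_analysis measurable_realfun.
From mathcomp Require Import ring lra.
Set Implicit Arguments.
Unset Strict Implicit.
Import Order.TTheory GRing.Theory Num.Theory.
Import numFieldNormedType.Exports.
Local Open Scope classical_set_scope.
Local Open Scope ring_scope.

(** * Partial derivatives and increments *)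

Section Analysis.
Context {R : realType} {d : nat}.
Notation V := 'rV[R]_d.
Implicit Types (f g : V -> R) (x y v : V) (i j : 'I_d).

(** The obstacle is regularity. [A f] is only bounded and measurable, so [r -> E[A f(X_r)]] need not
    be continuous and [phi] cannot be differentiated pointwise; a bound by [(b - a)^2] on every
    subinterval is what remains provable. The error terms are therefore arranged so that the rough
    functions [c] and [g] are only evaluated, while differences are taken of [f], [H f] and [H], to
    which the martingale property under [P] applies. The reference time of these differences is [b]
    and not [a]: the rough factor at time [r] is then known before the increment from [r] to [b]
    starts. Writing [e^h = 1 + H] is forced because [e^h] has no compact support; with [H = 0] at
    the cemetery it also gives [e^h] the value 1 there, in agreement with the density. The identity
    for [A f + A (H f)] is the definition of [Gamma (H, f)] rearranged with [e^h - H = 1], which is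
    why the correction has to be [Gamma (H, f) / e^h]. *)

Lemma is_derive_line f x v (t : R) : derivable f (t *: v + x) v ->
  is_derive t (1 : R) (fun s : R => f (s *: v + x)) ('D_v f (t *: v + x)).
Proof.
move=> df.
have E : (fun s : R => (s^-1 *: ((f \o shift (t *: v + x)) (s *: v) - f (t *: v + x)))) =
   (fun s : R => (s^-1 *: (((fun s : R => f (s *: v + x)) \o shift t) (s *: (1 : R)) - f
     (t *: v + x)))).
  apply/funext => s /=; congr (_ *: (f _ - _)).
  by rewrite scaler1 scalerDl addrA.
split; first by rewrite /derivable -E; exact: df.
by rewrite /derive -E.
Qed.

Lemma MVT_from0 (g dg : R -> R) (a : R) :
  (forall t : R, is_derive t (1 : R) g (dg t)) ->
  exists2 c, `|c| <= `|a| & g a - g 0 = dg c * a.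
Proof.
move=> gdg.
have cg : continuous g.
  move=> t; apply/differentiable_continuous/derivable1_diffP.
  by case: (gdg t).
have [a0|a0] := leP 0 a.
  have [c] := @MVT_segment R g dg 0 a a0 (fun u _ => gdg u) (continuous_subspaceT cg).
  rewrite in_itv/= => /andP[c0 ca] E; exists c; last by rewrite E subr0.
  by rewrite !ger0_norm.
have [c] := @MVT_segment R g dg a 0 (ltW a0) (fun u _ => gdg u) (continuous_subspaceT cg).
rewrite in_itv/= => /andP[ac c0] E; exists c.
  by rewrite !ler0_norm ?lerN2 // ltW.
by rewrite -opprB E sub0r mulrN opprK.
Qed.

Lemma MVT_line f x v (a : R) : (forall y, derivable f y v) ->
  exists2 c, `|c| <= `|a| & f (a *: v + x) - f x = 'D_v f (c *: v + x) * a.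
Proof.
move=> df.
have [t|c ca E] := @MVT_from0 (fun s => f (s *: v + x)) (fun s => 'D_v f (s *: v + x)) a.
  exact: is_derive_line.
by exists c => //; move: E; rewrite scale0r add0r.
Qed.

(** The vertices of the staircase from 0 to [xi] along the coordinate axes. *)
Definition trunc (xi : V) (k : nat) : V := \row_(j < d) (if (j < k)%N then xi 0 j else 0).

Lemma trunc0 xi : trunc xi 0 = 0.
Proof. by apply/rowP => j; rewrite !mxE. Qed.

Lemma truncT xi : trunc xi d = xi.
Proof. by apply/rowP => j; rewrite !mxE ltn_ord. Qed.

Lemma truncS xi (k : 'I_d) : trunc xi k.+1 = xi 0 k *: evec k + trunc xi k.
Proof.
apply/rowP => j; rewrite !mxE eqxx/= ltnS leq_eqVlt.
have [->|jk] := eqVneq j k; first by rewrite eqxx ltnn mulr1 addr0.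
by rewrite (negbTE (_ : (j : nat) != k)) // mulr0 add0r.
Qed.

Lemma rV_norm_le (v : V) (r : R) : 0 <= r -> (forall j, `|v 0 j| <= r) -> `|v| <= r.
Proof.
move=> r0 vr; rewrite /Num.norm/= mx_normrE (bigmax_le _ r0)// => -[i j] _ /=.
by rewrite (ord1 i).
Qed.

Lemma coord_norm_le (v : V) j : `|v 0 j| <= `|v|.
Proof. by rewrite [leRHS]/Num.norm/= mx_normrE; exact: (le_bigmax _ (fun ij => `|v ij.1 ij.2|) (0,
  j)). Qed.

(** The norm is the sup norm and each coordinate is dominated by that of [xi], so the whole
    staircase stays in any ball around 0 that contains [xi]. *)
Lemma norm_trunc_line (xi : V) (k : 'I_d) (c : R) : `|c| <= `|xi 0 k| ->
  `|c *: evec k + trunc xi k| <= `|xi|.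
Proof.
move=> cxi; apply: rV_norm_le => // j; rewrite !mxE eqxx/=.
have [->|jk] := eqVneq j k.
  by rewrite ltnn mulr1 addr0 (le_trans cxi)// coord_norm_le.
rewrite mulr0 add0r; case: ifP => _; first exact: coord_norm_le.
by rewrite normr0.
Qed.

(* Moving from [x] to [x + xi] one coordinate at a time only uses the partial
   derivatives, so total differentiability never has to be established. *)
Lemma increment_partials f x xi : (forall i y, derivable f y (evec i)) ->
  exists c : 'I_d -> V, (forall i, `|c i| <= `|xi|) /\
    f (x + xi) - f x = \sum_i pd i f (x + c i) * xi 0 i.
Proof.
move=> df.
have /choice[c hc] : forall i : 'I_d, exists c : V, `|c| <= `|xi| /\
    f (x + trunc xi i.+1) - f (x + trunc xi i) = pd i f (x + c) * xi 0 i.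
  move=> i; have [c ca E] := @MVT_line f (x + trunc xi i) (evec i) (xi 0 i) (df i).
  exists (c *: evec i + trunc xi i); split; first exact: norm_trunc_line.
  by rewrite truncS addrCA E /pd addrCA.
exists c; split=> [i|]; first by case: (hc i).
under eq_bigr do rewrite -(hc _).2.
have -> : f (x + xi) - f x = f (x + trunc xi d) - f (x + trunc xi 0).
  by rewrite truncT trunc0 addr0.
by rewrite -(telescope_sumr (fun k => f (x + trunc xi k)))// big_mkord.
Qed.

Lemma coord_norm_sqn (v : V) j : v 0 j ^+ 2 <= sqn v.
Proof. by rewrite /sqn (bigD1 j)//= lerDl sumr_ge0// => i _; exact: sqr_ge0. Qed.

Lemma norm_sqn (v : V) : `|v| ^+ 2 <= sqn v.
Proof.
rewrite -[leRHS]sqr_sqrtr; last by apply: sumr_ge0 => i _; exact: sqr_ge0.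
rewrite ler_sqr ?nnegrE ?sqrtr_ge0//; apply: rV_norm_le; first exact: sqrtr_ge0.
by move=> j; rewrite -sqrtr_sqr ler_wsqrtr// coord_norm_sqn.
Qed.

Lemma increment_le f x (del M : R) : (forall i y, derivable f y (evec i)) ->
  (forall i y, `|y - x| < del -> `|pd i f y| <= M) ->
  forall xi : V, `|xi| < del -> `|f (x + xi) - f x| <= d%:R * M * `|xi|.
Proof.
move=> df bM xi xid; have [c [hc ->]] := increment_partials x xi df.
apply: (le_trans (ler_norm_sum _ _ _)).
apply: (@le_trans _ _ (\sum_(i < d) (M * `|xi|))); last first.
  by rewrite sumr_const card_ord -[leLHS]mulr_natl mulrA.
apply: ler_sum => i _; rewrite normrM ler_pM// ?coord_norm_le//.
by apply: bM; rewrite addrAC subrr add0r (le_lt_trans (hc i)).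
Qed.

(** The coordinatewise mean value formula leaves the differences [pd i f (x + c i) - pd i f x]; the
    first-order bound applied to [pd i f] gives each of them a further factor [|xi|]. The two
    factors [d] come from the two sums over coordinates. *)
Lemma increment2_le f x (del M : R) : C2c f ->
  (forall i j y, `|y - x| < del -> `|pd i (pd j f) y| <= M) ->
  forall xi : V, `|xi| < del ->
   `|f (x + xi) - f x - \sum_i pd i f x * xi 0 i| <= d%:R * (d%:R * M) * `|xi| ^+ 2.
Proof.
move=> [_ df _ [_ ddf _]] bM xi xid; have [c [hc ->]] := increment_partials x xi df.
rewrite -sumrB; apply: (le_trans (ler_norm_sum _ _ _)).
apply: (@le_trans _ _ (\sum_(i < d) (d%:R * M * `|xi| ^+ 2))); last first.
  by rewrite sumr_const card_ord -[leLHS]mulr_natl !mulrA.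
apply: ler_sum => i _; rewrite -mulrBl normrM expr2 mulrA.
have cid : `|c i| < del by exact: le_lt_trans (hc i) xid.
have M0 : 0 <= M.
  by apply: le_trans (bM i i x _); rewrite // subrr normr0 (le_lt_trans _ cid).
apply: ler_pM => //; last exact: coord_norm_le.
apply: (le_trans (@increment_le (pd i f) x del M (fun j => ddf j i) (fun j => bM j i) (c i) cid)).
by rewrite ler_wpM2l// mulr_ge0.
Qed.

End Analysis.

(** * Functions of class C2c *)

Section C2c_closure.
Context {R : realType} {d : nat}.
Notation V := 'rV[R]_d.
Implicit Types (f g h : V -> R) (x y v : V) (i j : 'I_d).

Lemma continuous_add f g : continuous f -> continuous g ->
  continuous (fun x => f x + g x).
Proof. by move=> cf cg x; exact: (cvgD (cf x) (cg x)). Qed.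

Lemma continuous_mul f g : continuous f -> continuous g ->
  continuous (fun x => f x * g x).
Proof. by move=> cf cg x; exact: (cvgM (cf x) (cg x)). Qed.

Lemma derivable_mul f g x v : derivable f x v -> derivable g x v ->
  derivable (f \* g) x v.
Proof. exact: derivableM. Qed.

Lemma pd_mul f g i x : derivable f x (evec i) -> derivable g x (evec i) ->
  pd i (f \* g) x = f x * pd i g x + g x * pd i f x.
Proof. by move=> df dg; exact: (deriveM df dg). Qed.

Lemma pd_pd_mul f g i j x : (forall i x, derivable f x (evec i)) ->
  (forall i x, derivable g x (evec i)) ->
  derivable (pd j f) x (evec i) -> derivable (pd j g) x (evec i) ->
  pd i (pd j (f \* g)) x =
  (f x * pd i (pd j g) x + pd j g x * pd i f x) +
  (g x * pd i (pd j f) x + pd j f x * pd i g x).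
Proof.
move=> df dg ddf ddg.
have -> : pd j (f \* g) = (f \* pd j g) \+ (g \* pd j f).
  by apply/funext => y; rewrite (pd_mul (df j y) (dg j y)).
have d1 := derivable_mul (df i x) ddg.
have d2 := derivable_mul (dg i x) ddf.
transitivity (pd i (f \* pd j g) x + pd i (g \* pd j f) x); first exact: (deriveD d1 d2).
by rewrite (pd_mul (df i x) ddg) (pd_mul (dg i x) ddf).
Qed.

(** Only a directional derivative is given, so the one-variable chain rule is used on the line
    through [x] in direction [v], at parameter 0. *)
Lemma is_derive_expR_comp h x v : derivable h x v ->
  is_derive x v (fun y => expR (h y)) (expR (h x) * 'D_v h x).
Proof.
move=> dh.
have dl : is_derive (0 : R) (1 : R) (fun s : R => h (s *: v + x)) ('D_v h x).
  have E0 : 0 *: v + x = x by rewrite scale0r add0r.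
  by rewrite -[in 'D_v h x]E0; apply: is_derive_line; rewrite E0.
have de : is_derive (0 : R) (1 : R) (fun s : R => expR (h (s *: v + x))) (expR (h x) * 'D_v h x).
  have E0 : h x = h (0 *: v + x) by rewrite scale0r add0r.
  have de : is_derive (h (0 *: v + x)) (1 : R) expR (expR (h x))
    by rewrite E0; exact: is_derive_expR.
  exact: (@is_derive1_comp R expR (fun s : R => h (s *: v + x)) 0 _ _ de dl).
have E : (fun s : R => (s^-1 *: (((fun y => expR (h y)) \o shift x) (s *: v) - expR (h x)))) =
   (fun s : R => (s^-1 *: (((fun s : R => expR (h (s *: v + x))) \o shift 0) (s *: (1 : R)) - expR
     (h (0 *: v + x))))).
  by apply/funext => s /=; rewrite scale0r add0r scaler1 addr0.
case: de => d1 d2; split; first by rewrite /derivable E.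
by rewrite -d2 /derive E.
Qed.

Lemma expR_comp_continuous h : continuous h -> continuous (fun y => expR (h y)).
Proof. by move=> ch x; apply: continuous_comp; [exact: ch|exact: continuous_expR]. Qed.

Lemma C2c_mul f g : C2c f -> C2c g -> C2c (f \* g).
Proof.
move=> [cf df kf [cdf ddf cddf]] [cg dg kg [cdg ddg cddg]].
have E j : pd j (f \* g) = (fun x => f x * pd j g x + g x * pd j f x).
  by apply/funext => x; rewrite (pd_mul (df j x) (dg j x)).
have d1 i j x : derivable (f \* pd j g) x (evec i) by exact: derivable_mul.
have d2 i j x : derivable (g \* pd j f) x (evec i) by exact: derivable_mul.
split.
- exact: continuous_mul.
- by move=> i x; exact: derivable_mul.
- apply: subclosed_compact kf _; first exact: closed_closure.
  apply: closure_subset => x /=; apply: contra => /eqP fx.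
  by rewrite fx mul0r.
split.
- move=> j; rewrite E; by apply: continuous_add; apply: continuous_mul.
- by move=> i j x; rewrite E; exact: (derivableD (d1 i j x) (d2 i j x)).
- move=> i j.
  have -> : pd i (pd j (f \* g)) = (fun x => (f x * pd i (pd j g) x + pd j g x * pd i f x)
      + (g x * pd i (pd j f) x + pd j f x * pd i g x)).
    by apply/funext => x; rewrite (pd_pd_mul df dg (ddf i j x) (ddg i j x)).
  by apply: continuous_add; apply: continuous_add; apply: continuous_mul.
Qed.

Lemma derivable_expm1 h x v : derivable h x v ->
  is_derive x v (fun y => expR (h y) - 1) (expR (h x) * 'D_v h x).
Proof.
move=> dh; have [de E] := is_derive_expR_comp dh.
have dc : derivable (cst 1 : V -> R) x v by exact: derivable_cst.
split; first by exact: (derivableB de dc).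
by rewrite (deriveB de dc) E derive_cst subr0.
Qed.

Lemma pd_expm1 h i x : derivable h x (evec i) ->
  pd i (fun y => expR (h y) - 1) x = expR (h x) * pd i h x.
Proof. by move=> /derivable_expm1[]. Qed.

(** Subtracting 1 restores compact support: the function vanishes wherever [h] does. *)
Lemma C2c_expm1 h : C2c h -> C2c (fun x => expR (h x) - 1).
Proof.
move=> [ch dh kh [cdh ddh cddh]].
have ce := expR_comp_continuous ch.
have de i x : derivable (fun y => expR (h y)) x (evec i).
  by have [] := is_derive_expR_comp (dh i x).
have E j : pd j (fun x => expR (h x) - 1) = (fun y => expR (h y)) \* pd j h.
  by apply/funext => x; exact: pd_expm1.
split.
- by apply: continuous_add => //; exact: cst_continuous.
- by move=> i x; have [] := derivable_expm1 (dh i x).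
- apply: subclosed_compact kh _; first exact: closed_closure.
  apply: closure_subset => x /=; apply: contra => /eqP ->.
  by rewrite expR0 subrr.
split.
- by move=> j; rewrite E; exact: continuous_mul.
- by move=> i j x; rewrite E; exact: derivable_mul.
- move=> i j.
  have -> : pd i (pd j (fun x => expR (h x) - 1)) =
     (fun x => expR (h x) * pd i (pd j h) x + pd j h x * (expR (h x) * pd i h x)).
    apply/funext => x; rewrite E pd_mul//.
    by congr (_ + _ * _); case: (is_derive_expR_comp (dh i x)).
  by apply: continuous_add; apply: continuous_mul => //; exact: continuous_mul.
Qed.

Lemma C2c_bounded f : C2c f -> exists2 M : R, 0 <= M & forall x, `|f x| <= M.
Proof.
move=> [cf _ kf _].
have := continuous_compact (continuous_subspaceT cf) kf.
move=> /compact_bounded[M [Mr MP]].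
exists (`|M| + 1) => [|x]; first by rewrite addr_ge0.
have [->|fx] := eqVneq (f x) 0; first by rewrite normr0 addr_ge0.
apply: MP; first by rewrite ltr_pwDr// ler_norm.
by exists x => //; exact: subset_closure.
Qed.

End C2c_closure.

(** * Jump integrals *)

Lemma continuous_addl (K : numFieldType) (W : normedModType K) (x : W) :
  continuous (fun z => x + z).
Proof. by move=> z; apply: cvgD; [exact: cvg_cst|exact: cvg_id]. Qed.

Lemma continuous_compT (T U W : topologicalType) (f : T -> U) (g : U -> W) :
  continuous f -> continuous g -> continuous (fun x => g (f x)).
Proof. by move=> cf cg x; exact: (continuous_comp (cf x) (cg (f x))). Qed.

Section Levy_integrals.
Context {R : realType} {d : nat}.
Notation V := 'rV[R]_d.
Implicit Types (f g h : V -> R) (x y v xi : V) (i j : 'I_d).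

Lemma continuous_Rd_measurable g : continuous g ->
  measurable_fun (setT : set (Rd R d)) (g : Rd R d -> R).
Proof.
move=> /continuousP cg; apply: (measurability _ (RGenOpens.measurableE R)).
move=> _ [_ [a [b ->] <-]]; rewrite setTI; apply: sub_sigma_algebra.
by apply: cg; exact: interval_open.
Qed.

Lemma locally_bounded_fam (I : finType) (F : I -> V -> R) x :
  (forall k, {for x, continuous (F k)}) ->
  exists2 del : R, 0 < del & exists M : R, forall k y, `|y - x| < del -> `|F k y| <= M.
Proof.
move=> cF.
have : \forall y \near x, forall k, `|F k y| <= `|F k x| + 1.
  apply: (@filter_forall V I (fun k y => is_true (`|F k y| <= `|F k x| + 1)) (nbhs x) _) => k.
  have /cvgrPdist_le /(_ 1 ltr01) : F k y @[y --> x] --> F k x by exact: cF.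
  apply: filterS => y Fy; rewrite -lerBlDl.
  by rewrite (le_trans (lerB_dist _ _))// distrC.
move=> /nbhs_ballP[del /= del0 ball_del]; exists del => //.
exists (\sum_k (`|F k x| + 1)) => k y yx; rewrite (le_trans (ball_del y _ k))//.
  by rewrite -ball_normE /ball_/= distrC.
by rewrite (bigD1 k)//= lerDl sumr_ge0// => l _; rewrite addr_ge0.
Qed.

Lemma le_min_sqn g (M c del : R) : 0 < del -> (forall xi, `|g xi| <= M) ->
  (forall xi, `|xi| < del -> `|g xi| <= c * `|xi| ^+ 2) ->
  exists2 C : R, 0 <= C & forall xi, `|g xi| <= C * Num.min (sqn xi) 1.
Proof.
move=> del0 gM gc.
have M0 : 0 <= M by exact: le_trans (gM 0).
have dM0 : 0 <= M * del ^- 2 by rewrite mulr_ge0// invr_ge0 exprn_ge0// ltW.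
(* Three regimes: the global bound [M] where [sqn xi > 1]; the quadratic bound inside radius [del],
   with [|c|] because the sign of [c] is free; and in between [sqn xi >= |xi|^2 >= del^2], so that
   [M <= M * del^-2 * sqn xi]. *)
exists (M + `|c| + M * del ^- 2) => [|xi]; first by rewrite !addr_ge0.
have s0 : 0 <= sqn xi by apply: le_trans (norm_sqn xi); rewrite exprn_ge0.
have [s1|s1] := leP (sqn xi) 1; last first.
  by rewrite mulr1 (le_trans (gM xi))// -addrA lerDl addr_ge0.
have [xid|dxi] := ltP `|xi| del.
  rewrite (le_trans (gc xi xid))// (@le_trans _ _ (`|c| * sqn xi))//.
    apply: (@le_trans _ _ (`|c| * `|xi| ^+ 2)).
      by rewrite ler_wpM2r ?exprn_ge0// ler_norm.
    by rewrite ler_wpM2l// norm_sqn.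
  by rewrite ler_wpM2r// [M + _]addrC -addrA lerDl addr_ge0.
rewrite (le_trans (gM xi))// (@le_trans _ _ (M * del ^- 2 * sqn xi))//.
  rewrite -mulrA ler_peMr// mulrC ler_pdivlMr ?exprn_gt0// mul1r.
  by apply: le_trans (norm_sqn xi); rewrite lerXn2r ?nnegrE// ltW.
by rewrite ler_wpM2r// lerDr addr_ge0.
Qed.

(** * Integrability of the jump integrands at a fixed state *)

Section At_point.
Variables (m : {measure set Rd R d -> \bar R}) (chi : V -> V) (x : V).
Hypothesis cchi : continuous chi.
Hypothesis bchi : exists M : R, forall xi, `|chi xi| <= M.
Hypothesis idchi : \forall xi \near (0 : V), chi xi = xi.
Hypothesis m_fin : exists M : R, (\int[m]_xi (Num.min (sqn (xi : V)) 1)%:E <= M%:E)%E.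

Lemma sqn_ge0 (v : V) : 0 <= sqn v.
Proof. by apply: sumr_ge0 => i _; exact: sqr_ge0. Qed.

Lemma coord_continuous_row (i : 'I_d) : continuous (fun v : V => v 0 i).
Proof. by move=> v; exact: coord_continuous. Qed.

Lemma sqn_measurable : measurable_fun (setT : set (Rd R d)) (sqn : Rd R d -> R).
Proof.
apply: (@measurable_sum _ (Rd R d) R setT 'I_d _ (fun i v => (v : V) 0 i ^+ 2)) => i.
apply: measurable_funX; apply: continuous_Rd_measurable; exact: coord_continuous_row.
Qed.

Lemma integrable_min_sqn :
  m.-integrable setT (fun xi : Rd R d => (Num.min (sqn (xi : V)) 1)%:E).
Proof.
have mm : measurable_fun (setT : set (Rd R d)) (fun xi : Rd R d => (Num.min (sqn (xi : V)) 1)%:E).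
  by apply/measurable_EFinP; apply: measurable_minr => //; exact: sqn_measurable.
apply/integrableP; split => //.
have [M mM] := m_fin; apply: (@le_lt_trans _ _ M%:E); last exact: ltry.
apply: le_trans mM; apply: ge0_le_integral => //.
- exact: measurableT_comp.
- by move=> xi _; rewrite /= ger0_norm// le_min sqn_ge0 ler01.
Qed.

Lemma integrable_le_min_sqn g (C : R) : continuous g ->
  (forall xi, `|g xi| <= C * Num.min (sqn xi) 1) ->
  m.-integrable setT (EFin \o (g : Rd R d -> R)).
Proof.
move=> cg gC.
have := integrableZl measurableT C integrable_min_sqn.
apply: le_integrable => //.
  by apply/measurable_EFinP; exact: continuous_Rd_measurable.
by move=> xi _; rewrite /= lee_fin (le_trans (gC xi))// ler_norm.
Qed.

Lemma continuous_sum_fun (I : finType) (F : I -> V -> R) :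
  (forall k, continuous (F k)) -> continuous (fun v => \sum_k F k v).
Proof. by move=> cF; apply: continuous_big => [|k _]; [exact: add_continuous|exact: cF]. Qed.

Lemma continuous_shift f : continuous f -> continuous (fun xi => f (x + xi)).
Proof.
have c : continuous (fun z : V => x + z) by exact: continuous_addl.
by move=> cf xi; exact: (continuous_comp (c xi) (cf (x + xi))).
Qed.

Definition kjump f xi := f (x + xi) - f x - \sum_i pd i f x * chi xi 0 i.

Lemma chi_coord_continuous i : continuous (fun xi => chi xi 0 i).
Proof.
exact: (@continuous_compT V V R chi (fun v => v 0 i) cchi (@coord_continuous_row i)).
Qed.

Lemma kjump_continuous f : continuous f -> continuous (kjump f).
Proof.
move=> cf.
have -> : kjump f = fun xi => (f (x + xi) + (- f x)) + \sum_i (fun z => - pd i f x * chi z 0 i) xi.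
  apply/funext => xi; rewrite /kjump -sumrN; congr (_ + _).
  by apply: eq_bigr => i _; rewrite mulNr.
apply: (@continuous_add _ _ (fun xi => f (x + xi) + (- f x))).
  by apply: (@continuous_add _ _ (fun xi => f (x + xi)));
    [exact: continuous_shift|exact: cst_continuous].
apply: continuous_sum_fun => i; apply: continuous_mul; first exact: cst_continuous.
exact: chi_coord_continuous.
Qed.

Lemma chi_near : exists2 del : R, 0 < del & forall xi, `|xi| < del -> chi xi = xi.
Proof.
have /nbhs_ballP[del /= del0 B] := idchi.
by exists del => // xi xid; apply: B; rewrite -ball_normE /ball_/= sub0r normrN.
Qed.

(** Away from 0 boundedness of [f] and [chi] suffices; near 0, where [chi xi = xi], the integrand is
    the first-order Taylor remainder and hence quadratic in [xi]. *)
Lemma kjump_le f : C2c f ->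
  exists2 C : R, 0 <= C & forall xi, `|kjump f xi| <= C * Num.min (sqn xi) 1.
Proof.
move=> f2; have [F F0 fF] := C2c_bounded f2.
have [X chiX] := bchi; have [e e0 chie] := chi_near.
have [cf df _ [_ _ cddf]] := f2.
have [del del0 [M bM]] := @locally_bounded_fam ('I_d * 'I_d)%type
  (fun ij => pd ij.1 (pd ij.2 f)) x (fun ij => cddf ij.1 ij.2 x).
apply: (@le_min_sqn _ (F + F + \sum_i `|pd i f x| * X) (d%:R * (d%:R * M)) (Num.min del e)).
- by rewrite lt_min del0.
- move=> xi; rewrite /kjump; apply: (le_trans (ler_normB _ _)); apply: lerD.
    by apply: (le_trans (ler_normB _ _)); apply: lerD; exact: fF.
  apply: (le_trans (ler_norm_sum _ _ _)); apply: ler_sum => i _.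
  by rewrite normrM ler_wpM2l// (le_trans (coord_norm_le _ _)).
- move=> xi; rewrite lt_min => /andP[xid xie]; rewrite /kjump (chie _ xie).
  by apply: (@increment2_le _ _ f x del M) => // i j y; exact: (bM (i, j)).
Qed.

Lemma integrable_kjump f : C2c f -> m.-integrable setT (EFin \o (kjump f : Rd R d -> R)).
Proof.
move=> f2; have [C C0 kC] := kjump_le f2.
by apply: integrable_le_min_sqn kC; apply: kjump_continuous; case: f2.
Qed.

(** The density of the tilted jump kernel with respect to the original one. *)
Definition tilt h xi := expR (h (x + xi) - h x).

Lemma tilt_continuous h : continuous h -> continuous (tilt h).
Proof.
move=> ch; apply: expR_comp_continuous.
by apply: (@continuous_add _ _ (fun xi => h (x + xi)));
  [exact: continuous_shift|exact: cst_continuous].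
Qed.

Lemma tilt_bounded h : C2c h -> exists2 M : R, 0 <= M & forall xi, `|tilt h xi| <= M.
Proof.
move=> h2; have [F F0 hF] := C2c_bounded h2.
exists (expR (F + F)); first exact: expR_ge0.
move=> xi; rewrite /tilt ger0_norm ?expR_ge0// ler_expR.
by rewrite (le_trans (ler_norm _))// (le_trans (ler_normB _ _))// lerD.
Qed.

Lemma integrable_kjump_tilt f h : C2c f -> C2c h ->
  m.-integrable setT (EFin \o (fun xi : Rd R d => kjump f xi * tilt h xi)).
Proof.
move=> f2 h2; have [C C0 kC] := kjump_le f2.
have [M M0 tM] := tilt_bounded h2.
apply: (@integrable_le_min_sqn (fun xi => kjump f xi * tilt h xi) (C * M)).
  apply: continuous_mul; first by apply: kjump_continuous; case: f2.
  by apply: tilt_continuous; case: h2.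
by move=> xi; rewrite normrM mulrAC ler_pM.
Qed.

(** Near 0 both [tilt - 1] and [chi] are of order [|xi|], so their product is quadratic; this makes
    the jump correction of the drift finite even when the jumps are not summable. *)
Lemma integrable_tilt_chi h i : C2c h ->
  m.-integrable setT (EFin \o (fun xi : Rd R d => (tilt h xi - 1) * chi xi 0 i)).
Proof.
move=> h2; have [M M0 tM] := tilt_bounded h2.
have [X chiX] := bchi; have [e e0 chie] := chi_near.
have H2 := C2c_expm1 h2; have [_ dH _ [cdH _ _]] := H2.
have [del del0 [N bN]] := @locally_bounded_fam 'I_d
  (fun i => pd i (fun z => expR (h z) - 1)) x (fun i => cdH i x).
have [|xi|xi|C C0 gC] := @le_min_sqn (fun xi => (tilt h xi - 1) * chi xi 0 i)
    ((M + 1) * X) (expR (- h x) * (d%:R * N)) (Num.min del e).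
- by rewrite lt_min del0.
- rewrite normrM ler_pM//; last by rewrite (le_trans (coord_norm_le _ _)).
  by apply: (le_trans (ler_normB _ _)); rewrite normr1 lerD2r.
- rewrite lt_min => /andP[xid xie]; rewrite (chie _ xie).
  (* Up to the factor [e^(-h(x))] this is the increment of [e^h - 1], whose partial derivatives are
     bounded near [x]. *)
  have -> : tilt h xi - 1 = expR (- h x) * ((expR (h (x + xi)) - 1) - (expR (h x) - 1)).
    by rewrite /tilt opprB addrA subrK mulrBr -!expRD addNr expR0 [- h x + _]addrC.
  rewrite !normrM (ger0_norm (expR_ge0 _)) expr2 !mulrA ler_pM ?coord_norm_le ?mulr_ge0 ?expR_ge0//.
  rewrite -!mulrA ler_wpM2l ?expR_ge0// mulrA.
  by apply: (increment_le dH bN).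
- apply: integrable_le_min_sqn gC; apply: continuous_mul; last exact: chi_coord_continuous.
  apply: continuous_add; last exact: cst_continuous.
  by apply: tilt_continuous; case: h2.
Qed.

End At_point.
End Levy_integrals.

(** * The tilted generator *)

Lemma Rintegral_lincomb d0 (T : measurableType d0) (R : realType) (m : {measure set T -> \bar R})
    (I : Type) (r : seq I) (c : I -> R) (g : I -> T -> R) :
  (forall k, m.-integrable setT (EFin \o g k)) ->
  m.-integrable setT (EFin \o (fun z => \sum_(k <- r) c k * g k z)) /\
  Rintegral m setT (fun z => \sum_(k <- r) c k * g k z)
    = \sum_(k <- r) c k * Rintegral m setT (g k).
Proof.
move=> ig; elim: r => [|k r [IH1 IH2]].
  rewrite big_nil; under eq_fun do rewrite big_nil.
  by split; [exact: integrable0|rewrite /Rintegral integral0].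
rewrite big_cons; under eq_fun do rewrite big_cons.
have igk : m.-integrable setT (EFin \o (fun z => c k * g k z))
  by exact: (integrableZl measurableT (c k) (ig k)).
split; first exact: (integrableD measurableT igk IH1).
by rewrite RintegralD// RintegralZl// IH2.
Qed.

Lemma Rintegral_lin3 d0 (T : measurableType d0) (R : realType) (m : {measure set T -> \bar R})
    (a b c : R) (g1 g2 g3 : T -> R) :
  m.-integrable setT (EFin \o g1) -> m.-integrable setT (EFin \o g2) ->
  m.-integrable setT (EFin \o g3) ->
  a * Rintegral m setT g1 + b * Rintegral m setT g2 + c * Rintegral m setT g3 =
  Rintegral m setT (fun z => a * g1 z + b * g2 z + c * g3 z).
Proof.
move=> i1 i2 i3.
have j1 : m.-integrable setT (EFin \o (fun z => a * g1 z))
  by exact: (integrableZl measurableT a i1).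
have j2 : m.-integrable setT (EFin \o (fun z => b * g2 z))
  by exact: (integrableZl measurableT b i2).
have j3 : m.-integrable setT (EFin \o (fun z => c * g3 z))
  by exact: (integrableZl measurableT c i3).
rewrite (RintegralD (f1 := fun z => a * g1 z + b * g2 z) measurableT _ j3).
  by rewrite (RintegralD measurableT j1 j2) !RintegralZl.
exact: (integrableD measurableT j1 j2).
Qed.

Section Tilted_generator.
Context {R : realType} {d : nat}.
Notation V := 'rV[R]_d.
Variables (E : set V) (alpha : V -> 'M[R]_d) (beta : V -> V)
    (gamma : V -> R) (mu : V -> {measure set Rd R d -> \bar R}) (chi : V -> V).
Hypothesis data : levy_data E alpha beta gamma mu chi.
Variables (f h : V -> R) (x : V).
Hypotheses (f2 : C2c f) (h2 : C2c h) (Ex : E x).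
Notation H := (fun z => expR (h z) - 1).
Notation A := (Aop alpha beta gamma mu chi).

Let ex_neq0 : expR (h x) != 0. Proof. exact/lt0r_neq0/expR_gt0. Qed.

Lemma drift_mul : \sum_i beta x 0 i * pd i (H \* f) x =
  H x * (\sum_i beta x 0 i * pd i f x) + f x * (\sum_i beta x 0 i * pd i H x).
Proof.
have [[_ df _ _] [_ dH _ _]] := (f2, C2c_expm1 h2).
rewrite !mulr_sumr -big_split/=; apply: eq_bigr => i _.
rewrite (pd_mul (dH i x) (df i x)).
by move: (pd i f x) (pd i H x) (H x) (f x) (beta x 0 i) => *; ring.
Qed.

(** The Leibniz rule produces two mixed sums, which agree after exchanging the indices because
    [alpha x] is symmetric. The resulting factor 2 cancels the 1/2 of the generator, and the factor
    [e^h] of [pd H] cancels the division of [Gamma] by [e^h]; the drift [alpha grad h] is left. *)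
Lemma diffusion_mul : \sum_i \sum_j alpha x i j * pd i (pd j (H \* f)) x =
  H x * (\sum_i \sum_j alpha x i j * pd i (pd j f) x) +
  f x * (\sum_i \sum_j alpha x i j * pd i (pd j H) x) +
  2 * (expR (h x) * \sum_i (\sum_j alpha x i j * pd j h x) * pd i f x).
Proof.
have [_ _ /(_ x Ex)[alphaT _ _] _ _] := data.
have [[_ df _ [_ ddf _]] [_ dH _ [_ ddH _]]] := (f2, C2c_expm1 h2).
have [_ dh _ _] := h2.
have -> : 2 * (expR (h x) * \sum_i (\sum_j alpha x i j * pd j h x) * pd i f x) =
  \sum_i \sum_j alpha x i j * (pd j f x * pd i H x) +
  \sum_i \sum_j alpha x i j * (pd j H x * pd i f x).
  rewrite [X in X + _]exchange_big/=.
  have -> : \sum_j \sum_i alpha x i j * (pd j f x * pd i H x) =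
            \sum_i \sum_j alpha x i j * (pd j H x * pd i f x).
    apply: eq_bigr => i _; apply: eq_bigr => j _.
    by rewrite -[in LHS]alphaT mxE [in RHS](mulrC (pd j H x)).
  rewrite -mulr2n -[RHS]mulr_natl; congr (_ * _).
  rewrite mulr_sumr; apply: eq_bigr => i _; rewrite mulr_suml mulr_sumr.
  apply: eq_bigr => j _; rewrite (pd_expm1 (dh j x)).
  by move: (pd j h x) (pd i f x) (expR _) (alpha x i j) => *; ring.
rewrite !mulr_sumr -!big_split/=; apply: eq_bigr => i _.
rewrite !mulr_sumr -!big_split/=; apply: eq_bigr => j _.
rewrite (pd_pd_mul dH df (ddH i j x) (ddf i j x)).
move: (pd i (pd j f) x) (pd i (pd j H) x) (pd j f x) (pd i f x) (pd j H x) (pd i H x) (H x) (f x)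
  (alpha x i j).
by move=> *; ring.
Qed.

Let jump (g : V -> R) : R := Rintegral (mu x) setT (kjump chi x g : Rd R d -> R).

(** In the combination forming [Gamma] the compensators cancel and only the product of the
    increments of [H] and [f] survives; divided by [e^h], the increment of [H] is [tilt - 1]. The
    integrand is then the increment of [f] times [tilt] minus the untilted compensator. Tilting the
    compensator as well costs the term [(tilt - 1) * chi], which moves into the drift. *)
Lemma jump_mul :
  jump f + (jump (H \* f) - H x * jump f - f x * jump H) / expR (h x) =
  Rintegral (mu x) setT (fun xi : Rd R d => kjump chi x f xi * tilt x h xi) +
  \sum_i pd i f x * Rintegral (mu x) setT (fun xi : Rd R d => (tilt x h xi - 1) * chi xi 0 i).
Proof.
have [_ [cchi bchi idchi] _ _ bnd] := data.
have H2 := C2c_expm1 h2.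
have fin : exists M : R, (\int[mu x]_xi (Num.min (sqn (xi : V)) 1)%:E <= M%:E)%E.
  have [|M] := bnd [set x] (@compact_set1 _ x); first by move=> _ ->.
  by move=> /(_ x erefl)[_ _ _ ?]; exists M.
have ik g : C2c g -> (mu x).-integrable setT (EFin \o (kjump chi x g : Rd R d -> R)).
  exact: integrable_kjump.
have [iR LR] := Rintegral_lincomb (index_enum 'I_d) (fun i => pd i f x)
  (fun i => integrable_tilt_chi x cchi bchi idchi fin i h2).
have iT := integrable_kjump_tilt x cchi bchi idchi fin f2 h2.
have -> : jump f + (jump (H \* f) - H x * jump f - f x * jump H) / expR (h x) =
   (1 - H x / expR (h x)) * jump f + (expR (h x))^-1 * jump (H \* f) + - f x / expR (h x) * jump H.
  move: (jump f) (jump (H \* f)) (jump H) (H x) (f x) ex_neq0 => *; field; assumption.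
rewrite (Rintegral_lin3 _ _ _ (ik f f2) (ik (H \* f) (C2c_mul H2 f2)) (ik H H2)).
rewrite -LR -(RintegralD measurableT iT iR).
congr Rintegral; apply/funext => xi; rewrite /kjump /tilt.
have -> : \sum_i pd i f x * ((expR (h (x + xi) - h x) - 1) * chi xi 0 i) =
   (expR (h (x + xi) - h x) - 1) * \sum_i pd i f x * chi xi 0 i.
  by rewrite mulr_sumr; apply: eq_bigr => i _; rewrite mulrCA.
have -> : \sum_i pd i (H \* f) x * chi xi 0 i =
   H x * (\sum_i pd i f x * chi xi 0 i) + f x * (\sum_i pd i H x * chi xi 0 i).
  have [[_ df _ _] [_ dH _ _]] := (f2, H2).
  rewrite !mulr_sumr -big_split/=; apply: eq_bigr => i _.
  rewrite (pd_mul (dH i x) (df i x)).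
  by move: (pd i f x) (pd i H x) (H x) (f x) (chi xi 0 i) => *; ring.
rewrite expRD expRN /=.
move: (\sum_i pd i f x * chi xi 0 i) (\sum_i pd i H x * chi xi 0 i) ex_neq0 => S1 S2.
move: (expR (h x)) (expR (h (x + xi))) (f x) (f (x + xi)) => *; field; assumption.
Qed.

(** The killing term is the one part not governed by a product rule: it contributes [gamma * H * f]
    to [Gamma], and [1 - H / e^h = e^(-h)] yields the tilted killing rate. *)
Lemma tilted_generatorE :
  A f x + Gamma A H f x / expR (h x) =
          2^-1 * (\sum_i \sum_j alpha x i j * pd i (pd j f) x)
          + \sum_i (beta x 0 i + \sum_j alpha x i j * pd j h x
                    + Rintegral (mu x) setT
                        (fun xi : Rd R d => (expR (h (x + (xi : V)) - h x) - 1)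
                                             * chi xi 0 i))
                   * pd i f x
          - expR (- h x) * gamma x * f x
          + Rintegral (mu x) setT
              (fun xi : Rd R d =>
                 (f (x + (xi : V)) - f x - \sum_i pd i f x * chi xi 0 i)
                 * expR (h (x + (xi : V)) - h x)).
Proof.
pose DD g := \sum_i \sum_j alpha x i j * pd i (pd j g) x.
pose BB g := \sum_i beta x 0 i * pd i g x.
pose S := \sum_i (\sum_j alpha x i j * pd j h x) * pd i f x.
pose T := \sum_i pd i f x * Rintegral (mu x) setT (fun xi : Rd R d =>
  (tilt x h xi - 1) * chi xi 0 i).
pose Jt := Rintegral (mu x) setT (fun xi : Rd R d => kjump chi x f xi * tilt x h xi).
have Dm : DD (H \* f) = H x * DD f + f x * DD H + 2 * (expR (h x) * S) := diffusion_mul.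
have Bm : BB (H \* f) = H x * BB f + f x * BB H := drift_mul.
have Jm : jump f + (jump (H \* f) - H x * jump f - f x * jump H) / expR (h x) = Jt + T := jump_mul.
have AE g : A g x = 2^-1 * DD g + BB g - gamma x * g x + jump g by [].
transitivity (2^-1 * DD f + (BB f + S + T) - (expR (h x))^-1 * gamma x * f x + Jt); last first.
  rewrite -expRN; congr (_ + _ - _ + _).
  by rewrite -!big_split/=; apply: eq_bigr => i _; rewrite !mulrDl [in LHS](mulrC (pd i f x)).
rewrite /Gamma (AE (H \* f)) (AE H) (AE f) Dm Bm -[Jt](addrK T) -Jm [(H \* f) x]/=.
clear Dm Bm Jm AE; clearbody DD BB S T Jt.
move: (DD f) (DD H) (BB f) (BB H) S T (jump f) (jump H) (jump (H \* f)) ex_neq0.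
by move: (expR (h x)) (f x) (gamma x) => *; field; assumption.
Qed.

End Tilted_generator.

(** * Progressive measurability of the coordinate process *)

Section Coordinate_measurability.
Context {R : realType} {d : nat}.
Notation V := 'rV[R]_d.
Implicit Types (E : set V).

(* Measurability of an [option V]-valued map for the Borel sets of the one-point
   compactification. *)
Definition opt_measurable d0 (T : measurableType d0) (X : T -> option V) : Prop :=
  measurable [set w | X w = None] /\
  forall U : set V, open U -> measurable [set w | exists2 x, X w = Some x & U x].

Lemma opt_measurable_Borel d0 (T : measurableType d0) (X : T -> option V)
    (B : set (Rd R d)) : opt_measurable X -> measurable B ->
  measurable [set w | exists2 x, X w = Some x & B x].
Proof.
move=> [X0 XU]; pose G : set (set V) := [set B | measurable [set w | exists2 x, X w
  = Some x & B x]].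
suff : <<s @open V >> `<=` G by apply.
apply: smallest_sub => //; split.
- rewrite /G/= (_ : [set w | _] = set0)//.
  by apply/seteqP; split => // w [x].
- move=> A GA; rewrite /G/= (_ : [set w | _] =
    ~` ([set w | X w = None] `|` [set w | exists2 x, X w = Some x & A x])).
    by apply: measurableC; apply: measurableU.
  apply/seteqP; split => w /=.
    by move=> [x Xx [_ Ax]] [|[y]]; rewrite Xx// => -[<-].
  case Xw : (X w) => [x|] nX; last by exfalso; apply: nX; left.
  by exists x => //; split=> // Ax; apply: nX; right; exists x.
- move=> A GA; rewrite /G/= (_ : [set w | _] =
    \bigcup_k [set w | exists2 x, X w = Some x & A k x]).
    by apply: bigcupT_measurable => k; exact: GA.
  apply/seteqP; split => w /=.
    by move=> [x Xx [k _ Ak]]; exists k => //; exists x.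
  by move=> [k _ [x Xx Ak]]; exists x => //; exists k.
Qed.

Lemma measurable_ext d0 (T : measurableType d0) (X : T -> option V) E (g : V -> R) :
  opt_measurable X -> (forall w x, X w = Some x -> E x) ->
  measurable (E : set (Rd R d)) ->
  measurable_fun (E : set (Rd R d)) (g : Rd R d -> R) ->
  measurable_fun setT (fun w => ext g (X w)).
Proof.
move=> mX XE mE mg _ Y mY; rewrite setTI.
have -> : (fun w => ext g (X w)) @^-1` Y =
   [set w | exists2 x, X w = Some x & (E `&` g @^-1` Y) x] `|`
   ([set w | X w = None] `&` [set _ | Y 0]).
  apply/seteqP; split => w /=.
    case Xw : (X w) => [x|] /= Yx; last by right.
    by left; exists x => //; split=> //; exact: XE Xw.
  by case=> [[x -> [_]]//|[-> ]].
apply: measurableU.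
  by apply: opt_measurable_Borel => //; exact: mg.
have [X0 _] := mX.
have [Y0|Y0] := pselect (Y 0).
  by rewrite (_ : [set _ | Y 0] = setT) ?setIT//; apply/seteqP; split.
by rewrite (_ : [set _ | Y 0] = set0) ?setI0//; apply/seteqP; split.
Qed.

(** At [None] the approximants are asked to equal [None] eventually, not merely to escape to
    infinity. This makes the event [X = None] a liminf of events, and it is what absorption at the
    cemetery provides for approximation from the right. *)
Lemma opt_measurable_lim d0 (T : measurableType d0) (X : T -> option V)
    (Xn : nat -> T -> option V) : (forall n, opt_measurable (Xn n)) ->
  (forall w, X w = None -> \forall n \near \oo, Xn n w = None) ->
  (forall w x, X w = Some x -> forall e, 0 < e ->
     \forall n \near \oo, Defs.close (Some x) (Xn n w) e) ->
  opt_measurable X.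
Proof.
move=> mXn XN XS; split.
  rewrite (_ : [set w | _] = \bigcup_N \bigcap_(n in [set n | (N <= n)%N]) [set w | Xn n w = None]).
    apply: bigcupT_measurable => N; apply: bigcap_measurableType => n _.
    by have [] := mXn n.
  apply/seteqP; split => w /=.
    by move=> /XN[N _ NX]; exists N => // n /= Nn; exact: NX.
  move=> [N _ NX]; case Xw : (X w) => [x|//].
  have [M _ MX] := XS _ _ Xw 1 ltr01.
  have /= := MX (maxn M N) (leq_maxl _ _).
  by rewrite (NX (maxn M N))//= leq_maxr.
move=> U oU.
(* Points with a margin [1/(j+1)] inside [U]. The margin is needed because a limit of points of [U]
   may leave [U], whereas a limit of points of [F j] stays in [U]. *)
pose F (j : nat) : set V := [set y | forall z, `|z - y| < j.+1%:R^-1 -> U z].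
have oF j : open (~` F j).
  rewrite openE => y /= /existsNP[z /not_implyP[zy Uz]].
  apply/nbhs_ballP; exists (j.+1%:R^-1 - `|z - y|) => /=; first by rewrite subr_gt0.
  move=> t; rewrite -ball_normE /ball_/= => yt; apply/existsNP; exists z.
  apply/not_implyP; split => //.
  rewrite -[z](subrK y) -addrA (le_lt_trans (ler_normD _ _))//.
  by rewrite -ltrBrDl.
rewrite (_ : [set w | _] = \bigcup_j \bigcup_N
    \bigcap_(n in [set n | (N <= n)%N]) [set w | exists2 x, Xn n w = Some x & F j x]).
  apply: bigcupT_measurable => j; apply: bigcupT_measurable => N.
  apply: bigcap_measurableType => n _.
  apply: (@opt_measurable_Borel _ T (Xn n) (F j)) => //.
  rewrite -[X in measurable X]setCK; apply: measurableC.
  by apply: sub_sigma_algebra; exact: oF.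
apply/seteqP; split => w /=.
  move=> [x Xx Ux].
  have /nbhs_ballP[r /= r0 rU] : nbhs x U by exact: open_nbhs_nbhs.
  have [j _ jr] := near_infty_natSinv_lt (PosNum (divr_gt0 r0 (ltr0n _ 2))).
  have /= {}jr := jr j (leqnn j).
  have [N _ NX] := XS _ _ Xx _ (divr_gt0 r0 (ltr0n _ 2)).
  exists j => //; exists N => // n /= Nn.
  have := NX n Nn; rewrite /Defs.close; case: (Xn n w) => [y|//] yx.
  exists y => // z zy; apply: rU; rewrite -ball_normE /ball_/= distrC.
  rewrite -[z](subrK y) -addrA (le_lt_trans (ler_normD _ _))// [r]splitr.
  by rewrite ltrD// (lt_trans zy).
move=> [j _ [N _ NX]]; case Xw : (X w) => [x|]; last first.
  have [M _ MX] := XN _ Xw.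
  have /= := MX (maxn M N) (leq_maxl _ _).
  by have /= [y ->] := NX (maxn M N) (leq_maxr _ _).
exists x => //.
have j0 : (0 : R) < j.+1%:R^-1 by rewrite invr_gt0.
have [M _ MX] := XS _ _ Xw _ j0.
have /= := MX (maxn M N) (leq_maxl _ _).
have /= [y -> Fy] := NX (maxn M N) (leq_maxr _ _).
by rewrite /= => yx; apply: Fy; rewrite distrC.
Qed.

(** As [F] has countably many values, the preimages are countable unions of measurable
    rectangles. *)
Lemma opt_measurable_int d1 d2 (T1 : measurableType d1) (T2 : measurableType d2)
   (F : T1 -> int) (Y : int -> T2 -> option V) :
  (forall k, measurable [set s | F s = k]) -> (forall k, opt_measurable (Y k)) ->
  opt_measurable (fun p : T1 * T2 => Y (F p.1) p.2).
Proof.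
move=> mF mY.
have key (S : set (option V)) : (forall k, measurable [set w | S (Y k w)]) ->
    measurable [set p : T1 * T2 | S (Y (F p.1) p.2)].
  move=> mS.
  rewrite (_ : [set p | _] = \bigcup_(k : int) ([set s | F s = k] `*` [set w | S (Y k w)])).
    by apply: countable_bigcupT_measurable => // k; exact: measurableX.
  apply/seteqP; split => -[s w] /=; first by move=> SY; exists (F s).
  by move=> [k _ /= [-> ]].
split; first by apply: (key [set o | o = None]) => k; have [] := mY k.
move=> U oU; apply: (key [set o | exists2 x, o = Some x & U x]) => k.
by have [_] := mY k; exact.
Qed.

(** * The filtration and discretisation of paths in time *)

Section Paths.
Variable E : set V.

(** The sigma-algebra [Ft E t] as a measurable space on the same paths: adaptedness becomes
    measurability on [Ot t], and the inclusion of two sigma-algebras becomes measurability of the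
    identity. *)
Definition Ot (t : R) : measurableType _ := g_sigma_algebraType (coord_gen E [set s | 0 <= s <= t]).

Lemma opt_measurable_coord (t s : R) : 0 <= s <= t ->
  opt_measurable (fun w : Ot t => pval w s).
Proof.
move=> st; split; first by apply: sub_sigma_algebra; exists s; split => //; left.
by move=> U oU; apply: sub_sigma_algebra; exists s; split => //; right; exists U.
Qed.

(** Projection of time onto [[0, t]]. It makes the coordinate process a jointly measurable function
    on all of [R * Ot t], while integrals over subintervals of [[0, t]] are unaffected. *)
Definition clip (t s : R) : R := Num.max 0 (Num.min t s).

Lemma clip_id t s : 0 <= s <= t -> clip t s = s.
Proof. by move=> /andP[s0 st]; rewrite /clip min_r// max_r. Qed.

Lemma clip_itv t s : 0 <= t -> 0 <= clip t s <= t.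
Proof.
by move=> t0; rewrite /clip le_max lexx/= ge_max t0/= ge_min lexx.
Qed.

Lemma clip_shift t s e : 0 <= e -> clip t s <= clip t (s + e) <= clip t s + e.
Proof.
rewrite /clip => e0.
have [?|?] := leP t s; have [?|?] := leP t (s + e); rewrite /Order.max; do ?case: ifPn;
  rewrite -?leNgt => *; lra.
Qed.

Definition grid_above (n : nat) (s : R) : R := ((Num.floor (n.+1%:R * s))%:~R + 1) / n.+1%:R.

Lemma grid_above_itv n s : exists e : R, [/\ 0 <= e, e <= n.+1%:R^-1 & grid_above n s = s + e].
Proof.
exists (grid_above n s - s); split; last by rewrite addrC subrK.
  rewrite subr_ge0 /grid_above ler_pdivlMr// mulrC ltW//.
  by have /andP[_] := floor_itv (n.+1%:R * s); rewrite intrD.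
by rewrite lerBlDl /grid_above ler_pdivrMr// mulrDl mulVf// lerD2r mulrC floor_le.
Qed.

Lemma measurable_floor_fiber (c : R) (k : int) : 0 < c ->
  measurable [set s : R | Num.floor (c * s) = k].
Proof.
move=> c0; rewrite (_ : [set s | _] = `[k%:~R / c, (k + 1)%:~R / c[%classic).
  exact: measurable_itv.
apply/seteqP; split => s /=; rewrite in_itv/= ler_pdivrMr// ltr_pdivlMr// (mulrC s).
  by move=> <-; exact: floor_itv.
by move=> H; apply/eqP; rewrite floor_eq.
Qed.

Lemma path_absorbed (w : Defs.path E) (s t : R) : 0 <= s -> s <= t ->
  pval w s = None -> pval w t = None.
Proof. by case: w => w [_ _ _ _ ab] /= s0 st ws; apply: (ab s) => //; left. Qed.

Lemma path_in (w : Defs.path E) s x : pval w s = Some x -> E x.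
Proof. by case: w => w [_ wE _ _ _] /=; exact: wE. Qed.

(* Progressive measurability: right-continuity makes the path the limit of its
   discretisations at the grid points just above the current time. *)
Lemma opt_measurable_joint (t : R) : 0 <= t ->
  opt_measurable (fun p : measurableTypeR R * Ot t => pval p.2 (clip t p.1)).
Proof.
move=> t0.
apply: (@opt_measurable_lim _ _ _ 
  (fun n (p : measurableTypeR R * Ot t) => pval p.2 (clip t (grid_above n p.1)))).
- move=> n.
  apply: (@opt_measurable_int _ _ _ _ (fun s : measurableTypeR R => Num.floor (n.+1%:R * s))
    (fun k (w : Ot t) => pval w (clip t ((k%:~R + 1) / n.+1%:R)))) => k.
    exact: measurable_floor_fiber.
  by apply: opt_measurable_coord; exact: clip_itv.
- move=> [s w] /= Xw; near=> n.
  have [e [e0 _ ->]] := grid_above_itv n s.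
  have /andP[ss' _] := clip_shift t s e0.
  by apply: path_absorbed ss' Xw; have /andP[] := clip_itv s t0.
- move=> [s w] x /= Xw eps eps0.
  have /andP[s0 _] := clip_itv s t0.
  have [_ _ rc _ _] := @pvalP R d E w.
  have [del del0 delP] := rc _ s0 _ eps0.
  have [N _ NP] := near_infty_natSinv_lt (PosNum del0).
  exists N => // n /= /NP /= nd.
  have [e [e0 en ->]] := grid_above_itv n s.
  have /andP[s1 s2] := clip_shift t s e0.
  have := delP (clip t (s + e)); rewrite Xw; apply; rewrite s1/= (le_lt_trans s2)// ltrD2l.
  exact: le_lt_trans nd.
Unshelve. all: by end_near. Qed.

End Paths.
End Coordinate_measurability.

(** * Expectations and time integrals *)

Section Bounded_measurable.
Context {R : realType}.

(** All integrands below, the density included, are bounded on a finite horizon; this class is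
    stable under ring operations, exponentials and time integrals, so integrability and Fubini hold
    throughout. *)
Definition bmfun d0 (T : measurableType d0) (Y : T -> R) : Prop :=
  measurable_fun setT Y /\ exists M : R, forall w, `|Y w| <= M.

Section Closure.
Context d0 (T : measurableType d0).
Implicit Types Y Z : T -> R.

Lemma bm_cst (c : R) : bmfun (fun _ : T => c).
Proof. by split; [exact: measurable_cst|exists `|c|]. Qed.

Lemma bm_add Y Z : bmfun Y -> bmfun Z -> bmfun (fun w => Y w + Z w).
Proof.
move=> [mY [M YM]] [mZ [N ZN]]; split; first exact: measurable_funD.
by exists (M + N) => w; rewrite (le_trans (ler_normD _ _))// lerD.
Qed.

Lemma bm_mul Y Z : bmfun Y -> bmfun Z -> bmfun (fun w => Y w * Z w).
Proof.
move=> [mY [M YM]] [mZ [N ZN]]; split; first exact: measurable_funM.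
by exists (M * N) => w; rewrite normrM ler_pM.
Qed.

Lemma bm_opp Y : bmfun Y -> bmfun (fun w => - Y w).
Proof.
move=> [mY [M YM]]; split; first exact: measurableT_comp.
by exists M => w; rewrite normrN.
Qed.

Lemma bm_sub Y Z : bmfun Y -> bmfun Z -> bmfun (fun w => Y w - Z w).
Proof. by move=> bY bZ; apply: bm_add => //; exact: bm_opp. Qed.

Lemma bm_expR Y : bmfun Y -> bmfun (fun w => expR (Y w)).
Proof.
move=> [mY [M YM]]; split; first exact: measurableT_comp.
exists (expR M) => w; rewrite ger0_norm ?expR_ge0// ler_expR.
exact: le_trans (ler_norm _) (YM w).
Qed.

Lemma bm_indic (B : set T) : measurable B -> bmfun (\1_B : T -> R).
Proof.
move=> mB; split; first exact: measurable_indic.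
by exists 1 => w; rewrite indicE; case: (_ \in _); rewrite ?normr1 ?normr0.
Qed.

Lemma bm_bounded Y : bmfun Y -> exists2 M : R, 0 <= M & forall w, `|Y w| <= M.
Proof. by move=> [_ [M YM]]; exists M => //; exact: le_trans (YM point). Qed.

Lemma bm_integrable (m : {measure set T -> \bar R}) A Y : measurable A -> (m A < +oo)%E ->
  bmfun Y -> m.-integrable A (EFin \o Y).
Proof.
move=> mA fA [mY [M YM]]; apply: measurable_bounded_integrable => //.
  exact: measurable_funS mY.
exists M; split; first exact: num_real.
by move=> N MN w _; exact: le_trans (YM w) (ltW MN).
Qed.

End Closure.

Lemma bm_comp d0 d1 (T : measurableType d0) (T1 : measurableType d1) (Y : T -> R)
    (phi : T1 -> T) : bmfun Y -> measurable_fun setT phi -> bmfun (fun w => Y (phi w)).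
Proof.
by move=> [mY [M YM]] mphi; split; [exact: measurableT_comp|exists M].
Qed.

Lemma bm_pair1 d0 d1 (T : measurableType d0) (T1 : measurableType d1) (Y : T * T1 -> R) (w : T1) :
  bmfun Y -> bmfun (fun r => Y (r, w)).
Proof. by move=> [mY [M YM]]; split; [exact: measurable_fun_pair1|exists M]. Qed.

Lemma bm_pair2 d0 d1 (T : measurableType d0) (T1 : measurableType d1) (Y : T * T1 -> R) (r : T) :
  bmfun Y -> bmfun (fun w => Y (r, w)).
Proof. by move=> [mY [M YM]]; split; [exact: measurable_fun_pair2|exists M]. Qed.

Section Expectation.
Context d0 (T : measurableType d0) (P : probability T R).
Implicit Types Y Z : T -> R.

Definition expect Y : R := Rintegral P setT Y.

Lemma prob_integrable Y : bmfun Y -> P.-integrable setT (EFin \o Y).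
Proof. by move=> bY; apply: bm_integrable => //; rewrite fin_num_fun_lty. Qed.

Lemma expect_EFin Y : bmfun Y -> (expect Y)%:E = (\int[P]_w (Y w)%:E)%E.
Proof. by move=> bY; rewrite /expect /Rintegral fineK// integrable_fin_num//;
  exact: prob_integrable. Qed.

Lemma expect_add Y Z : bmfun Y -> bmfun Z -> expect (fun w => Y w + Z w) = expect Y + expect Z.
Proof. by move=> bY bZ; apply: RintegralD => //; exact: prob_integrable. Qed.

Lemma expect_sub Y Z : bmfun Y -> bmfun Z -> expect (fun w => Y w - Z w) = expect Y - expect Z.
Proof. by move=> bY bZ; apply: RintegralB => //; exact: prob_integrable. Qed.

Lemma expect_cst (c : R) : expect (fun=> c) = c.
Proof. rewrite /expect Rintegral_cst; last exact: measurableT.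
transitivity (c * fine 1%E); last by rewrite mulr1.
by congr (c * fine _); exact: probability_setT. Qed.

Lemma expect_norm_le Y (C : R) : bmfun Y -> (forall w, `|Y w| <= C) -> `|expect Y| <= C.
Proof.
move=> bY YC; have iY := prob_integrable bY.
apply: le_trans (le_normr_Rintegral measurableT iY) _.
rewrite -[leRHS]expect_cst; apply: le_Rintegral => //.
- by have := integrable_norm iY; apply: eq_integrable.
- exact/prob_integrable/bm_cst.
Qed.

End Expectation.

Section Time_integral.
Notation leb := (@lebesgue_measure R).
Implicit Types f g : R -> R.

Definition tint (a b : R) f : R := Rintegral leb `[a, b] f.

Notation TR := (measurableTypeR R).

Lemma tint_integrable a b (f : TR -> R) : bmfun f -> leb.-integrable `[a, b] (EFin \o f).
Proof.
move=> bf; apply: bm_integrable => //=.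
by rewrite lebesgue_measure_itv/= lte_fin; case: ifP => _; rewrite ?ltry.
Qed.

Lemma tint_add a b (f g : TR -> R) : bmfun f -> bmfun g ->
  tint a b (fun r => f r + g r) = tint a b f + tint a b g.
Proof. by move=> bf bg; apply: RintegralD => //; exact: tint_integrable. Qed.

Lemma tint_sub a b (f g : TR -> R) : bmfun f -> bmfun g ->
  tint a b (fun r => f r - g r) = tint a b f - tint a b g.
Proof. by move=> bf bg; apply: RintegralB => //; exact: tint_integrable. Qed.

Lemma tint_scale a b (c : R) (f : TR -> R) : bmfun f -> tint a b (fun r => c * f r)
  = c * tint a b f.
Proof. by move=> bf; apply: RintegralZl => //; exact: tint_integrable. Qed.

Lemma tint_cst a b (c : R) : a <= b -> tint a b (fun=> c) = c * (b - a).
Proof.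
move=> ab; rewrite /tint Rintegral_cst//= lebesgue_measure_itv/= lte_fin.
have [//|ba] := ltP a b; have -> : a = b by apply/eqP; rewrite eq_le ab ba.
by rewrite subrr mulr0.
Qed.

Lemma eq_tint a b f g : (forall r, a <= r <= b -> f r = g r) -> tint a b f = tint a b g.
Proof.
move=> fg; apply: eq_Rintegral => r; rewrite inE/= in_itv/=; exact: fg.
Qed.

Lemma tint_norm_le a b (f : TR -> R) (C : R) : a <= b -> bmfun f ->
  (forall r, a <= r <= b -> `|f r| <= C) -> `|tint a b f| <= C * (b - a).
Proof.
move=> ab bf fC; have jf := tint_integrable a b bf.
apply: le_trans (le_normr_Rintegral _ jf) _ => //.
rewrite -tint_cst//; apply: le_Rintegral => //.
- by have := integrable_norm jf; apply: eq_integrable.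
- exact/tint_integrable/bm_cst.
Qed.

Lemma tint_split a b c (f : TR -> R) : bmfun f -> a <= b -> b <= c ->
  tint a c f = tint a b f + tint b c f.
Proof.
move=> bf ab bc; have jf := tint_integrable a c bf.
have := @Rintegral_itvB R f (BLeft a) (BRight c) b jf; rewrite !bnd_simp => /(_ ab bc).
rewrite Rintegral_itv_obnd_cbnd; first by move=> E; rewrite /tint -E addrC subrK.
apply: integrableS (tint_integrable b c bf) => //= r /=.
by rewrite !in_itv/= => /andP[/ltW -> ->].
Qed.

Lemma bm_tint d0 (T : measurableType d0) (Phi : TR * T -> R) (a b : R) : bmfun Phi ->
  a <= b -> bmfun (fun w => tint a b (fun r => Phi (r, w))).
Proof.
move=> bPhi ab; have [M M0 PhiM] := bm_bounded bPhi.
have bs w : bmfun (fun r : TR => Phi (r, w)) by exact: (@bm_pair1 _ _ TR T Phi w bPhi).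
split; last by exists (M * (b - a)) => w; apply: tint_norm_le.
(* Tonelli needs a nonnegative integrand, hence the shift by the bound [M]; its integral
   [M * (b - a)] is subtracted afterwards. *)
pose g (p : TR * T) : \bar R := ((fun p => Phi p + M) \_ (`[a, b] `*` setT) p)%:E.
have mD : measurable (`[a, b]%classic `*` setT : set (TR * T)).
  by apply: measurableX => //; exact: measurable_itv.
have mg : measurable_fun setT g.
  apply/measurable_EFinP; apply/(measurable_restrictT _ mD).
  by apply: measurable_funTS; apply: measurable_funD => //; case: bPhi.
have g0 p : (0 <= g p)%E.
  rewrite /g lee_fin /patch; case: ifP => _ //.
  by have := PhiM p; rewrite ler_norml -lerBlDr sub0r => /andP[].
have := @measurable_fun_fubini_tonelli_G _ _ TR T R (@lebesgue_measure R) g mg g0.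
have -> : (fun w => tint a b (fun r => Phi (r, w))) =
  (fun w => fine (fubini_G (@lebesgue_measure R) g w) - M * (b - a)).
  apply/funext => w.
  have -> : fine (fubini_G (@lebesgue_measure R) g w) = tint a b (fun r => Phi (r, w) + M).
    rewrite /tint Rintegral_mkcond /Rintegral /fubini_G; congr fine.
    apply: eq_integral => r _; rewrite /g /patch; congr (EFin (if _ then _ else _)).
    by apply/idP/idP; rewrite !inE/=; [move=> []|].
  by rewrite tint_add//; [rewrite tint_cst// addrK|exact: bm_cst].
move=> mG; apply: measurable_funB => //; first exact: measurableT_comp.
Qed.

Lemma expect_tint d0 (T : measurableType d0) (P : probability T R) (Phi : TR * T -> R) (a b : R) :
  bmfun Phi -> a <= b ->
  bmfun (fun r : TR => expect P (fun w => Phi (r, w))) /\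
  expect P (fun w => tint a b (fun r => Phi (r, w)))
    = tint a b (fun r => expect P (fun w => Phi (r, w))).
Proof.
move=> bPhi ab; have [M M0 PhiM] := bm_bounded bPhi.
have bs w : bmfun (fun r : TR => Phi (r, w)) by exact: (@bm_pair1 _ _ TR T Phi w bPhi).
have bw r : bmfun (fun w => Phi (r, w)) by exact: (@bm_pair2 _ _ TR T Phi r bPhi).
split.
  split; last by exists M => r; apply: expect_norm_le.
  pose g (p : TR * T) : \bar R := (Phi p + M)%:E.
  have mg : measurable_fun setT g.
    by apply/measurable_EFinP; apply: measurable_funD => //; case: bPhi.
  have g0 p : (0 <= g p)%E.
    by rewrite lee_fin; have := PhiM p; rewrite ler_norml -lerBlDr sub0r => /andP[].
  have := @measurable_fun_fubini_tonelli_F _ _ TR T R P g mg g0.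
  have -> : (fun r => expect P (fun w => Phi (r, w))) = (fun r => fine (fubini_F P g r) - M).
    apply/funext => r.
    have -> : fine (fubini_F P g r) = expect P (fun w => Phi (r, w) + M) by [].
    by rewrite expect_add//; [rewrite expect_cst addrK|exact: bm_cst].
  by move=> mF; apply: measurable_funB => //; exact: measurableT_comp.
(* Restricted to this strip the product measure is finite, so the bounded [Phi] is integrable and
   Fubini applies. *)
pose D : set (TR * T) := `[a, b]%classic `*` setT.
have mD : measurable D by apply: measurableX => //; exact: measurable_itv.
have fD : ((@lebesgue_measure R \x P) D < +oo)%E.
  rewrite product_measure1E//= lebesgue_measure_itv/= lte_fin.
  by case: ifP => _; rewrite ?mul0e ?ltry//= lte_mul_pinfty ?fin_num_fun_lty// lee_fin subr_ge0.
have iPhi := bm_integrable mD fD bPhi.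
have := (integrable_mkcond (EFin \o Phi) mD).1 iPhi.
move=> /Fubini.
have -> : (fun r : TR => \int[P]_w ((EFin \o Phi) \_ D) (r, w))%E =
    ((EFin \o (fun r => expect P (fun w => Phi (r, w)))) \_ `[a, b]).
  apply/funext => r; rewrite [RHS]/patch /=.
  have [rab|rab] := boolP (r \in `[a, b]%classic).
    rewrite expect_EFin//; apply: eq_integral => w _; rewrite /patch.
    by rewrite ifT// inE; split => //; move: rab; rewrite inE.
  rewrite integral0_eq// => w _; rewrite /patch ifF//; apply/negbTE; move: rab.
  by apply: contra; rewrite !inE => -[].
have -> : (fun w : T => \int[@lebesgue_measure R]_r ((EFin \o Phi) \_ D) (r, w))%E =
    EFin \o (fun w => tint a b (fun r => Phi (r, w))).
  apply/funext => w /=; rewrite /tint /Rintegral fineK; last first.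
    by apply: integrable_fin_num; rewrite //=; exact: tint_integrable.
  rewrite [RHS]integral_mkcond; apply: eq_integral => r _; rewrite /patch.
  by congr (if _ then _ else _); apply/idP/idP; rewrite !inE; [move=> []|].
rewrite -integral_mkcond => E.
by rewrite /expect /tint /Rintegral E.
Qed.

End Time_integral.

(** Cutting [[s, t]] into [n + 1] equal pieces bounds the total increment by [n + 1] times
    [C ((t - s) / (n + 1))^2], which tends to 0. *)
Lemma eq_of_quadratic_increments (phi : R -> R) (s t C : R) : s <= t ->
  (forall a b, s <= a -> a <= b -> b <= t -> `|phi b - phi a| <= C * (b - a) ^+ 2) ->
  phi t = phi s.
Proof.
move=> st H; apply/eqP; rewrite -subr_eq0 -normr_le0.
have key (n : nat) : `|phi t - phi s| <= C * (t - s) ^+ 2 / n.+1%:R.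
  pose x (k : nat) : R := s + (t - s) * k%:R / n.+1%:R.
  have n0 : n.+1%:R != 0 :> R by rewrite pnatr_eq0.
  have x0 : x 0%N = s by rewrite /x mulr0 mul0r addr0.
  have xn : x n.+1 = t by rewrite /x mulfK// addrC subrK.
  have xS k : x k.+1 - x k = (t - s) / n.+1%:R.
    by rewrite /x -[k.+1%:R]natr1; field.
  have xle k : x k <= x k.+1 by rewrite -subr_ge0 xS divr_ge0// subr_ge0.
  have xmono : {homo x : k l / (k <= l)%N >-> k <= l} 
    by apply: homo_leq => //; exact: le_trans.
  rewrite -{1}xn -{1}x0 -(telescope_sumr (fun k => phi (x k)))//.
  apply: (le_trans (ler_norm_sum _ _ _)); rewrite big_mkord.
  apply: (@le_trans _ _ (\sum_(k < n.+1) (C * ((t - s) / n.+1%:R) ^+ 2))).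
    apply: ler_sum => k _; rewrite -(xS k); apply: H => //.
      by rewrite -x0; exact: xmono.
    by rewrite -xn; exact: xmono.
  rewrite sumr_const card_ord -[leLHS]mulr_natl le_eqVlt; apply/orP; left; apply/eqP.
  by field.
apply/ler_addgt0Pr => e e0; rewrite add0r.
(* The sign of [C] is free; if the product is not positive, a single piece already decides. *)
have [K|K] := leP (C * (t - s) ^+ 2) 0.
  by apply: (le_trans (key 0)); rewrite divr1 (le_trans K)// ltW.
have [n _ nP] := near_infty_natSinv_lt (PosNum (divr_gt0 e0 K)).
apply: (le_trans (key n)); have /= := nP n (leqnn n).
by rewrite ltr_pdivlMr// mulrC => /ltW.
Qed.

End Bounded_measurable.

(** * Changes of measure on a sub-sigma-algebra *)

Lemma step_approx (R : realType) d1 (T : measurableType d1) (Y : T -> R) (e : R) :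
  bmfun Y -> 0 < e -> exists (K : nat) (c : 'I_K -> R) (B : 'I_K -> set T),
   (forall k, measurable (B k)) /\ forall w, `|Y w - \sum_k c k * \1_(B k) w| <= e.
Proof.
move=> bY e0; have [M M0 YM] := bm_bounded bY.
pose z w := e^-1 * (Y w + M).
have YM0 w : 0 <= Y w + M by have := YM w; rewrite ler_norml -lerBlDr sub0r => /andP[].
have z0 w : 0 <= z w by rewrite mulr_ge0// invr_ge0 ltW.
(* [Y + M] lies in [[0, 2 M]], so the cells of width [e] have indices up to the integer part of
   [2 M / e]. The value [e k - M] chosen on cell [k] is its lower end, whence the error at most
   [e]. *)
pose K := (Num.truncn (e^-1 * (M + M))).+1.
exists K, (fun k : 'I_K => e * k%:R - M), (fun k => [set w | Num.floor (z w) = k%:Z]).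
split=> [k|w].
  have e'0 : 0 < e^-1 by rewrite invr_gt0.
  have mYM : measurable_fun setT (fun w => Y w + M).
    by apply: measurable_funD => //; case: bY.
  by have := mYM measurableT _ (measurable_floor_fiber k%:Z e'0); rewrite setTI.
pose m := Num.truncn (z w).
have zm : Num.floor (z w) = m%:Z.
  by rewrite /m truncn_floor z0 gez0_abs// floor_ge0.
have mK : (m < K)%N.
  rewrite ltnS; apply: le_truncn; rewrite /z ler_wpM2l ?invr_ge0 ?(ltW e0)// lerD2r.
  exact: le_trans (ler_norm _) (YM w).
rewrite (bigD1 (Ordinal mK))//= big1 ?addr0 => [|k km]; last first.
  rewrite indicE memNset ?mulr0//= zm => -[mk].
  by move/eqP: km; apply; apply/val_inj.
rewrite indicE mem_set//= mulr1.
have -> : Y w - (e * m%:R - M) = e * (z w - m%:R).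
  by rewrite mulrBr /z mulVKf ?gt_eqF// opprB addrA addrAC.
have := floor_itv (z w); rewrite zm intrD => /andP[mz zm1].
rewrite normrM gtr0_norm// ger_pMr// ger0_norm ?subr_ge0//.
by rewrite lerBlDl ltW// addrC.
Qed.

Lemma bm_sum (R : realType) d0 (T : measurableType d0) (I : Type) (r : seq I) (F : I -> T -> R) :
  (forall k, bmfun (F k)) -> bmfun (fun w => \sum_(k <- r) F k w).
Proof.
move=> bF; elim: r => [|k r IH].
  by under eq_fun do rewrite big_nil; exact: bm_cst.
by under eq_fun do rewrite big_cons; exact: bm_add.
Qed.

(* Step functions carry the identity from sets to bounded integrands; it serves both
   for changes of measure and for conditional expectations. *)
Lemma density_expect (R : realType) d0 d1 (T : measurableType d0) (T1 : measurableType d1)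
    (phi : T -> T1) (P1 P2 : probability T R) (D1 D2 : T -> R) :
  measurable_fun setT phi -> bmfun D1 -> bmfun D2 ->
  (forall B, measurable B ->
     (\int[P1]_(w in phi @^-1` B) (D1 w)%:E = \int[P2]_(w in phi @^-1` B) (D2 w)%:E)%E) ->
  forall Y : T1 -> R, bmfun Y ->
    expect P1 (fun w => Y (phi w) * D1 w) = expect P2 (fun w => Y (phi w) * D2 w).
Proof.
move=> mphi b1 b2 H Y bY.
have bYphi : bmfun (fun w => Y (phi w)) by exact: bm_comp bY mphi.
have indE (P : probability T R) (D : T -> R) B : measurable B ->
    expect P (fun w => \1_B (phi w) * D w) = fine (\int[P]_(w in phi @^-1` B) (D w)%:E)%E.
  move=> mB; rewrite /expect /Rintegral [in RHS]integral_mkcond; congr fine.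
  apply: eq_integral => w _; rewrite /patch indicE.
  have -> : (w \in phi @^-1` B) = (phi w \in B) by apply/idP/idP; rewrite !inE.
  by case: ifP => _; rewrite ?mul1r ?mul0r.
have indb (D : T -> R) B : measurable B -> bmfun D -> bmfun (fun w => \1_B (phi w) * D w).
  by move=> mB bD; apply: bm_mul => //; apply: bm_comp mphi; exact: bm_indic.
have [M1 M10 D1M] := bm_bounded b1; have [M2 M20 D2M] := bm_bounded b2.
apply/eqP; rewrite -subr_eq0 -normr_le0; apply/ler_addgt0Pr => e e0; rewrite add0r.
(* A uniform error [e / (M1 + M2 + 1)] in [Y] costs at most that times [M1] on one side and times
   [M2] on the other, together at most [e]; the 1 keeps the denominator positive. *)
have M0 : 0 < M1 + M2 + 1 by rewrite ltr_wpDl// addr_ge0.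
have [K [c [B [mB YB]]]] := step_approx bY (divr_gt0 e0 M0).
pose S w := \sum_k c k * \1_(B k) w.
have bS : bmfun S by apply: bm_sum => k; apply: bm_mul; [exact: bm_cst|exact: bm_indic].
have ExS (P : probability T R) (D : T -> R) : bmfun D ->
    expect P (fun w => S (phi w) * D w) = \sum_k c k * expect P (fun w => \1_(B k) (phi w) * D w).
  move=> bD.
  have [_ <-] := Rintegral_lincomb (index_enum 'I_K) c
    (fun k => prob_integrable P (indb D (B k) (mB k) bD)).
  congr Rintegral; apply/funext => w; rewrite /S mulr_suml.
  by apply: eq_bigr => k _; rewrite mulrA.
have close_S (P : probability T R) (D : T -> R) M : bmfun D -> (forall w, `|D w| <= M) ->
    `|expect P (fun w => Y (phi w) * D w) - expect P (fun w => S (phi w) * D w)| <= e /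
      (M1 + M2 + 1) * M.
  move=> bD DM; have bSphi : bmfun (fun w => S (phi w)) by exact: bm_comp bS mphi.
  rewrite -expect_sub; [|exact: bm_mul|exact: bm_mul].
  apply: expect_norm_le => [|w]; first by apply: bm_sub; exact: bm_mul.
  by rewrite -mulrBl normrM ler_pM// YB.
have E12 : expect P1 (fun w => S (phi w) * D1 w) = expect P2 (fun w => S (phi w) * D2 w).
  by rewrite !ExS//; apply: eq_bigr => k _; rewrite !indE// H.
have c1 := close_S P1 D1 M1 b1 D1M.
have c2 := close_S P2 D2 M2 b2 D2M.
rewrite -(subrKA (expect P1 (fun w => S (phi w) * D1 w))) {2}E12.
apply: (le_trans (ler_normD _ _)); rewrite (distrC (expect P2 _) (expect P2 _)).
apply: (le_trans (lerD c1 c2)).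
rewrite -mulrDr -mulrA ler_piMr ?(ltW e0)// mulrC ler_pdivrMr// mul1r lerDl.
exact: ler01.
Qed.

(** * Martingale increments *)

Section Process.
Context {R : realType} {d : nat}.
Notation V := 'rV[R]_d.
Notation TR := (measurableTypeR R).
Variable E : set V.
Hypothesis closedE : closed E.
Implicit Types (k g : V -> R) (Y : Defs.path E -> R) (a b r s t : R).

Lemma measurableE : measurable (E : set (Rd R d)).
Proof.
rewrite -[X in measurable X]setCK; apply: measurableC.
by apply: sub_sigma_algebra; exact: closed_openC.
Qed.

Definition X k r (w : Defs.path E) : R := ext k (pval w r).
Definition IX k a b (w : Defs.path E) : R := tint a b (fun r => X k r w).

Definition adapted t Y : Prop := bmfun (T := Ot E t) Y.
Definition bmO Y : Prop := bmfun (T := Omega E) Y.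

Lemma sub_id_measurable d0 (T : measurableType d0) t (phi : T -> Ot E t) :
  (forall A, coord_gen E [set s | 0 <= s <= t] A -> measurable (phi @^-1` A)) ->
  measurable_fun setT phi.
Proof.
by move=> H; apply: (@measurability _ _ T (Ot E t) setT phi
  (coord_gen E [set s | 0 <= s <= t]) erefl) => _ [A GA <-]; rewrite setTI; exact: H.
Qed.

Lemma coord_gen_sub (I J : set R) : I `<=` J -> coord_gen E I `<=` coord_gen E J.
Proof. by move=> IJ A [s [Is H]]; exists s; split => //; exact: IJ. Qed.

Lemma Ot_le_measurable s t : s <= t -> measurable_fun setT (id : Ot E t -> Ot E s).
Proof.
move=> st; apply: sub_id_measurable => A GA; apply: sub_sigma_algebra.
by apply: coord_gen_sub GA => u /= /andP[-> us]; exact: le_trans us st.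
Qed.

Lemma Omega_Ot_measurable t : measurable_fun setT (id : Omega E -> Ot E t).
Proof.
apply: sub_id_measurable => A GA; apply: sub_sigma_algebra.
by apply: coord_gen_sub GA => u /= /andP[].
Qed.

Lemma adapted_le s t Y : s <= t -> adapted s Y -> adapted t Y.
Proof. by move=> st aY; exact: (bm_comp aY (Ot_le_measurable st)). Qed.

Lemma adapted_bmO t Y : adapted t Y -> bmO Y.
Proof. by move=> aY; exact: (bm_comp aY (@Omega_Ot_measurable t)). Qed.

Lemma X_le k (M : R) r w : (forall x, E x -> `|k x| <= M) -> 0 <= M -> `|X k r w| <= M.
Proof.
move=> kM M0; rewrite /X; case Xw : (pval w r) => [x|] /=; last by rewrite normr0.
exact: kM (path_in Xw).
Qed.

Lemma bmeas_bound k : bmeas E k -> exists2 M : R, 0 <= M & forall x, E x -> `|k x| <= M.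
Proof.
move=> [_ [M kM]]; exists `|M| => // x Ex; exact: le_trans (kM x Ex) (ler_norm _).
Qed.

Lemma bm_joint k t : bmeas E k -> 0 <= t ->
  bmfun (fun p : TR * Ot E t => X k (clip t p.1) p.2).
Proof.
move=> bk t0; have [M M0 kM] := bmeas_bound bk; split.
  apply: measurable_ext (opt_measurable_joint E t0) _ measurableE _; last by case: bk.
  by move=> p x; exact: path_in.
by exists M => p; exact: X_le.
Qed.

Lemma bm_joint_Omega k t : bmeas E k -> 0 <= t ->
  bmfun (fun p : TR * Omega E => X k (clip t p.1) p.2).
Proof.
move=> bk t0.
apply: (@bm_comp R _ _ _ _ (fun p : TR * Ot E t => X k (clip t p.1) p.2)
  (fun p : TR * Omega E => (p.1, (p.2 : Ot E t)))); first exact: bm_joint.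
apply: measurable_fun_pair; first exact: measurable_fst.
exact: (measurableT_comp (@Omega_Ot_measurable t) measurable_snd).
Qed.

Lemma bm_time k t w : bmeas E k -> 0 <= t -> bmfun (fun r : TR => X k (clip t r) w).
Proof. by move=> bk t0; exact: (@bm_pair1 R _ _ TR (Ot E t) _ w (bm_joint bk t0)). Qed.

Lemma adapted_X k r t : bmeas E k -> 0 <= r <= t -> adapted t (X k r).
Proof.
move=> bk rt; have [M M0 kM] := bmeas_bound bk; split.
  apply: measurable_ext (opt_measurable_coord E rt) _ measurableE _; last by case: bk.
  by move=> p x; exact: path_in.
by exists M => p; exact: X_le.
Qed.

Lemma IX_clip k a b t w : 0 <= a -> b <= t -> IX k a b w = tint a b (fun r => X k (clip t r) w).
Proof.
move=> a0 bt; apply: eq_tint => r /andP[ar rb]; rewrite clip_id//.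
by rewrite (le_trans a0 ar) (le_trans rb bt).
Qed.

Lemma adapted_IX k a b t : bmeas E k -> 0 <= a -> a <= b -> b <= t -> adapted t (IX k a b).
Proof.
move=> bk a0 ab bt; have t0 : 0 <= t by exact: le_trans a0 (le_trans ab bt).
rewrite (_ : IX k a b = fun w => tint a b (fun r => X k (clip t r) w)); last first.
  by apply/funext => w; exact: IX_clip.
exact: (bm_tint (bm_joint bk t0) ab).
Qed.

Lemma IX_split k a b c w : bmeas E k -> 0 <= a -> a <= b -> b <= c ->
  IX k a c w = IX k a b w + IX k b c w.
Proof.
move=> bk a0 ab bc; have c0 : 0 <= c by exact: le_trans a0 (le_trans ab bc).
rewrite (@IX_clip k a c c)// (@IX_clip k a b c)// (@IX_clip k b c c) ?(le_trans a0)//.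
exact: (tint_split (bm_time w bk c0)).
Qed.

Lemma IX_le k (M : R) a b w : bmeas E k -> (forall x, E x -> `|k x| <= M) -> 0 <= M ->
  0 <= a -> a <= b -> `|IX k a b w| <= M * (b - a).
Proof.
move=> bk kM M0 a0 ab; rewrite (@IX_clip k a b b)//.
apply: tint_norm_le => //; first by apply: bm_time => //; exact: le_trans ab.
by move=> r _; exact: X_le.
Qed.

Lemma C2c_bmeas f : C2c f -> bmeas E f.
Proof.
move=> f2; split.
  by apply: measurable_funTS; apply: continuous_Rd_measurable; case: f2.
by have [M _ fM] := C2c_bounded f2; exists M => x _.
Qed.

Lemma mp_processE (A : (V -> R) -> V -> R) f t w :
  mp_process E A f t w = X f t w - X f 0 w - IX (A f) 0 t w.
Proof. by []. Qed.

Section Martingale_increments.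
Variables (P : probability (Omega E) R) (A : (V -> R) -> V -> R).
Hypothesis bA : forall f, C2c f -> bmeas E (A f).
Hypothesis solP : solves_mp E P A.

Lemma adapted_indic t (B : set (Defs.path E)) : Ft E t B -> adapted t \1_B.
Proof. by move=> FB; apply: bm_indic. Qed.

Lemma adapted_mp f t : C2c f -> bmeas E (A f) -> 0 <= t -> adapted t (mp_process E A f t).
Proof.
move=> f2 bAf t0; apply: (@bm_sub R _ (Ot E t)); first apply: (@bm_sub R _ (Ot E t)).
- by apply: (@adapted_X f t t); [exact: C2c_bmeas|rewrite t0/=].
- by apply: (@adapted_X f 0 t); [exact: C2c_bmeas|rewrite lexx].
- exact: (@adapted_IX (A f) 0 t t).
Qed.

(** The martingale property on sets of [Ft E s] extends to bounded weights known at time [s]: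
    [density_expect] is used with [P] on both sides and the values of the martingale at [t] and [s]
    as densities. *)
Lemma mart_increment f s t Y : C2c f -> 0 <= s -> s <= t -> adapted s Y ->
  expect P (fun w => Y w * (X f t w - X f s w)) = expect P (fun w => Y w * IX (A f) s t w).
Proof.
move=> f2 s0 st aY; have t0 := le_trans s0 st.
have bAf := bA f2; have bf := C2c_bmeas f2.
have bN r : 0 <= r -> bmO (mp_process E A f r).
  by move=> r0; apply: (@adapted_bmO r); exact: adapted_mp.
have [_ M2] := solP f2.
have := @density_expect R _ _ (Omega E) (Ot E s) id P P (mp_process E A f t) (mp_process E A f s)
  (@Omega_Ot_measurable s) (bN t t0) (bN s s0).
have H (B : set (Ot E s)) : measurable B ->
     (\int[P]_(w in id @^-1` B) (mp_process E A f t w)%:E =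
      \int[P]_(w in id @^-1` B) (mp_process E A f s w)%:E)%E.
  by move=> mB; apply: M2 => //; rewrite s0.
move=> /(_ H Y aY) /eqP; rewrite -subr_eq0.
have bY := adapted_bmO aY.
have bXf r : 0 <= r -> bmO (X f r).
  by move=> r0; apply: (@adapted_bmO r); apply: adapted_X; rewrite // r0/=.
have bI : bmO (IX (A f) s t) by apply: (@adapted_bmO t); exact: adapted_IX.
rewrite -expect_sub; [|by apply: bm_mul => //; exact: bN|by apply: bm_mul => //; exact: bN].
move=> /eqP E0; apply/eqP; rewrite -subr_eq0; apply/eqP.
rewrite -expect_sub; [|by apply: bm_mul => //; apply: bm_sub; exact: bXf|exact: bm_mul].
rewrite -[RHS]E0; congr expect; apply/funext => w.
by rewrite !mp_processE (@IX_split (A f) 0 s t)//; ring.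
Qed.

Lemma mart_increment_le f (M C : R) s t Y : C2c f -> 0 <= s -> s <= t -> adapted s Y ->
  (forall x, E x -> `|A f x| <= M) -> 0 <= M -> (forall w, `|Y w| <= C) ->
  `|expect P (fun w => Y w * (X f t w - X f s w))| <= C * (M * (t - s)).
Proof.
move=> f2 s0 st aY AM M0 YC; rewrite mart_increment//; apply: expect_norm_le.
  apply: bm_mul; first exact: (adapted_bmO aY).
  by apply: (@adapted_bmO t); apply: adapted_IX => //; exact: bA.
by move=> w; rewrite normrM ler_pM// IX_le//; exact: bA.
Qed.

(* Conditioning on time [r] inside the time integral gains a second factor [b - a]. *)
Lemma integrated_increment_le f k (M N C : R) a b Y : C2c f -> bmeas E k ->
  0 <= a -> a <= b -> adapted a Y ->
  (forall x, E x -> `|A f x| <= M) -> 0 <= M -> (forall x, E x -> `|k x| <= N) -> 0 <= N ->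
  (forall w, `|Y w| <= C) ->
  `|expect P (fun w => Y w * tint a b (fun r => X k r w * (X f r w - X f b w)))| <=
  C * N * M * (b - a) ^+ 2.
Proof.
move=> f2 bk a0 ab aY AM M0 kN N0 YC; have b0 := le_trans a0 ab.
have bf := C2c_bmeas f2; have bY := adapted_bmO aY.
have C0 : 0 <= C by apply: le_trans (YC point).
pose Phi (p : TR * Omega E) : R :=
  Y p.2 * (X k (clip b p.1) p.2 * (X f (clip b p.1) p.2 - X f b p.2)).
have snd_bm (Z : Omega E -> R) : bmO Z -> bmfun (fun p : TR * Omega E => Z p.2).
  by move=> bZ; apply: bm_comp bZ _; exact: measurable_snd.
have bXb : bmO (X f b) by apply: (@adapted_bmO b); apply: adapted_X; rewrite // b0/=.
have bPhi : bmfun Phi.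
  apply: bm_mul; first exact: snd_bm.
  apply: bm_mul; first exact: bm_joint_Omega.
  by apply: bm_sub; [exact: bm_joint_Omega|exact: snd_bm].
have -> : (fun w => Y w * tint a b (fun r => X k r w * (X f r w - X f b w))) =
    (fun w => tint a b (fun r => Phi (r, w))).
  apply/funext => w.
  rewrite (@eq_tint R a b _ (fun r => X k (clip b r) w * (X f (clip b r) w - X f b w))).
    rewrite -tint_scale//; apply: bm_mul; first exact: bm_time.
    by apply: bm_sub; [exact: bm_time|exact: bm_cst].
  by move=> r /andP[ar rb]; rewrite clip_id// (le_trans a0 ar).
have [b1 ->] := expect_tint P bPhi ab.
have -> : C * N * M * (b - a) ^+ 2 = C * N * (M * (b - a)) * (b - a) by ring.
apply: tint_norm_le => // r /andP[ar rb]; have r0 := le_trans a0 ar.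
(* The sign turns the difference into a forward increment from [r] to [b], with a weight known at
   time [r]; the martingale estimate can then start at [r]. *)
have -> : (fun w => Phi (r, w)) = (fun w => - (Y w * X k r w) * (X f b w - X f r w)).
  by apply/funext => w; rewrite /Phi/= clip_id ?r0//; ring.
apply: (@le_trans _ _ (C * N * (M * (b - r)))).
  apply: mart_increment_le => //.
    apply: (@bm_opp R _ (Ot E r)); apply: bm_mul; first exact: adapted_le aY.
    by apply: adapted_X; rewrite // r0/=.
  by move=> w; rewrite normrN normrM ler_pM// X_le.
by rewrite ler_wpM2l ?mulr_ge0// ler_wpM2l// lerD2l lerN2.
Qed.

End Martingale_increments.
End Process.

(** * Change of measure *)

(** Both sides come from [1 + x <= e^x]: directly for the lower bound, and at [- x], multiplied by
    [e^x], for the upper bound [e^x - 1 <= x e^x]. *)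
Lemma expR_sub1_le (R : realType) (x : R) : `|expR x - 1| <= `|x| * expR `|x|.
Proof.
have lo : x <= expR x - 1 by rewrite lerBrDl expR_ge1Dx.
have hi : expR x - 1 <= x * expR x.
  have := expR_ge1Dx (- x); rewrite expRN => H.
  have : expR x * (1 + - x) <= 1.
    by rewrite -[leRHS](mulfV (lt0r_neq0 (expR_gt0 x))) ler_wpM2l ?expR_ge0.
  rewrite mulrDr mulr1 mulrN => H2; lra.
have e1 : 1 <= expR `|x| by rewrite -expR0 ler_expR.
have ex : expR x <= expR `|x| by rewrite ler_expR ler_norm.
rewrite ler_norml; apply/andP; split.
  have := ler_norm (- x); rewrite normrN => nx.
  have : `|x| <= `|x| * expR `|x| by rewrite ler_peMr.
  lra.
apply: (le_trans hi); apply: (@le_trans _ _ (`|x| * expR x)).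
  by rewrite ler_wpM2r ?expR_ge0// ler_norm.
by rewrite ler_wpM2l.
Qed.

(** The bound [e^x - 1 <= x e^x] rearranges to [e^x - 1 - x <= x (e^x - 1)], and the previous
    estimate supplies the second factor [|x|]. *)
Lemma expR_sub1x_le (R : realType) (x : R) : `|expR x - 1 - x| <= `|x| ^+ 2 * expR `|x|.
Proof.
have lo : 0 <= expR x - 1 - x by rewrite subr_ge0 lerBrDl expR_ge1Dx.
have hi : expR x - 1 - x <= x * (expR x - 1).
  have := expR_ge1Dx (- x); rewrite expRN => H.
  have : expR x * (1 + - x) <= 1.
    by rewrite -[leRHS](mulfV (lt0r_neq0 (expR_gt0 x))) ler_wpM2l ?expR_ge0.
  rewrite mulrDr mulr1 mulrN mulrBr mulr1 => H2; lra.
rewrite ger0_norm//; apply: (le_trans hi); apply: (le_trans (ler_norm _)).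
rewrite normrM expr2 -mulrA ler_wpM2l//; exact: expR_sub1_le.
Qed.

Section Change_of_measure.
Context {R : realType} {d : nat}.
Notation V := 'rV[R]_d.
Notation TR := (measurableTypeR R).
Variable E : set V.
Hypothesis closedE : closed E.
Variables (P Q : probability (Omega E) R) (A : (V -> R) -> V -> R) (h : V -> R).
Hypothesis bA : forall f, C2c f -> bmeas E (A f).
Hypothesis solP : solves_mp E P A.
Hypothesis h2 : C2c h.

Lemma bmeas_add (k g : V -> R) : bmeas E k -> bmeas E g -> bmeas E (fun x => k x + g x).
Proof.
move=> [mk [M kM]] [mg [N gN]]; split; first exact: measurable_funD.
by exists (M + N) => x Ex; rewrite (le_trans (ler_normD _ _))// lerD// ?kM ?gN.
Qed.

Lemma bmeas_opp (k : V -> R) : bmeas E k -> bmeas E (fun x => - k x).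
Proof.
move=> [mk [M kM]]; split; first exact: measurableT_comp.
by exists M => x Ex; rewrite normrN kM.
Qed.

Lemma bmeas_mul (k g : V -> R) : bmeas E k -> bmeas E g -> bmeas E (fun x => k x * g x).
Proof.
move=> [mk [M kM]] [mg [N gN]]; split; first exact: measurable_funM.
by exists (M * N) => x Ex; rewrite normrM ler_pM// ?kM ?gN.
Qed.

Lemma bmeas_expR (k : V -> R) : bmeas E k -> bmeas E (fun x => expR (k x)).
Proof.
move=> [mk [M kM]]; split; first exact: measurableT_comp.
exists (expR M) => x Ex; rewrite ger0_norm ?expR_ge0// ler_expR.
exact: le_trans (ler_norm _) (kM x Ex).
Qed.

Let H (x : V) := expR (h x) - 1.
Let c (x : V) := A H x / expR (h x).
Let At (f : V -> R) (x : V) := A f x + Gamma A H f x / expR (h x).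

Let H2 : C2c H. Proof. exact: C2c_expm1. Qed.
Let HF2 f : C2c f -> C2c (H \* f). Proof. exact: C2c_mul. Qed.

Lemma bmeas_divexp (k : V -> R) : bmeas E k -> bmeas E (fun x => k x / expR (h x)).
Proof.
move=> bk; have -> : (fun x => k x / expR (h x)) = (fun x => k x * expR (- h x)).
  by apply/funext => x; rewrite expRN.
by apply: bmeas_mul => //; apply/bmeas_expR/bmeas_opp/C2c_bmeas.
Qed.

Lemma bmeas_tilted f : C2c f -> bmeas E (At f).
Proof.
move=> f2; apply: bmeas_add; first exact: bA.
apply: bmeas_divexp; apply: bmeas_add; first apply: bmeas_add.
- exact/bA/HF2.
- by apply/bmeas_opp/bmeas_mul; [exact: C2c_bmeas|exact: bA].
- by apply/bmeas_opp/bmeas_mul; [exact: C2c_bmeas|exact: bA].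
Qed.

Let bc : bmeas E c. Proof. exact/bmeas_divexp/bA. Qed.

Let D (t : R) (w : Omega E) :=
    expR (ext h (pval w t) - ext h (pval w 0)) *
    expR (- Rintegral (@lebesgue_measure R) `[0, t]
              (fun s => ext (A H) (pval w s) / expR (ext h (pval w s)))).

Hypothesis HQ : forall t, 0 <= t -> forall B : set (Omega E), Ftplus E t B ->
     Q B = (\int[P]_(w in B) (D t w)%:E)%E.

Lemma densityE (t : R) (w : Defs.path E) : D t w = expR (X h t w - X h 0 w) * expR (- IX c 0 t w).
Proof.
(* The two integrands agree also at the cemetery, where both are 0. *)
rewrite /D; congr (_ * expR (- Rintegral _ _ _)); apply/funext => s.
by rewrite /X; case: (pval w s) => [x|] //=; rewrite mul0r.
Qed.

Lemma adapted_density t : 0 <= t -> adapted t (D t).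
Proof.
move=> t0; rewrite (_ : D t = fun w => expR (X h t w - X h 0 w) * expR (- IX c 0 t w)); last first.
  by apply/funext => w; exact: densityE.
apply: (@bm_mul R _ (Ot E t)); apply: bm_expR; last first.
  by apply: bm_opp; exact: adapted_IX.
by apply: (@bm_sub R _ (Ot E t)); apply: adapted_X; rewrite ?lexx ?t0//; exact: C2c_bmeas.
Qed.

Lemma Ft_Ftplus t : Ft E t `<=` Ftplus E t.
Proof.
move=> B FB u tu; have := @Ot_le_measurable R d E t u (ltW tu) measurableT B FB.
by rewrite setTI.
Qed.

(** [density_expect] with density 1 under [Q] and density [D t] under [P]. *)
Lemma expect_change t (Y : Defs.path E -> R) : 0 <= t -> adapted t Y ->
  expect Q Y = expect P (fun w => Y w * D t w).
Proof.
move=> t0 aY.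
have := @density_expect R _ _ (Omega E) (Ot E t) id Q P (fun=> 1) (D t)
  (@Omega_Ot_measurable R d E t) (bm_cst _ _) (adapted_bmO (adapted_density t0)).
move=> H0; rewrite -H0//; first by congr expect; apply/funext => w; rewrite mulr1.
move=> B mB.
have mB' : measurable (B : set (Omega E)).
  by have := @Omega_Ot_measurable R d E t measurableT B mB; rewrite setTI.
rewrite integral_cst// mul1e -HQ//; exact: Ft_Ftplus.
Qed.

Section One_function.
Variable f : V -> R.
Hypothesis f2 : C2c f.

(** The identity [A f + A (H f) = c (f + H f) + (1 + H) At f] holds at each time [r]. Here [f + H f]
    and [1 + H] are frozen at time [b] on the left, and the right-hand side is exactly the price of
    freezing them. *)
Lemma increment_identity (a b : R) (w : Defs.path E) : 0 <= a -> a <= b ->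
  IX (A f) a b w + IX (A (H \* f)) a b w
  - (IX c a b w * (X f b w + X (H \* f) b w) + (1 + X H b w) * IX (At f) a b w) =
  tint a b (fun r => X c r w * (X f r w - X f b w)) +
  tint a b (fun r => X c r w * (X (H \* f) r w - X (H \* f) b w)) +
  tint a b (fun r => X (At f) r w * (X H r w - X H b w)).
Proof.
move=> a0 ab; have b0 := le_trans a0 ab.
have bmt k : bmeas E k -> bmfun (fun r : TR => X k (clip b r) w) by move=> bk; exact: bm_time.
have bf : bmeas E f := C2c_bmeas E f2.
have bHf : bmeas E (H \* f) := C2c_bmeas E (HF2 f2).
have bH : bmeas E H := C2c_bmeas E H2.
have bt k g : bmeas E k -> bmeas E g ->
    bmfun (fun r : TR => X k (clip b r) w * (X g (clip b r) w - X g b w)).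
  move=> bk bg; apply: bm_mul; first exact: bmt.
  by apply: bm_sub; [exact: bmt|exact: bm_cst].
have ct k g : tint a b (fun r => X k r w * (X g r w - X g b w)) =
    tint a b (fun r => X k (clip b r) w * (X g (clip b r) w - X g b w)).
  by apply: eq_tint => r /andP[ar rb]; rewrite clip_id// (le_trans a0 ar).
rewrite !ct -tint_add; [|exact: bt|exact: bt].
have btl := bmeas_tilted f2.
have bAf := bA f2; have bAHf := bA (HF2 f2).
rewrite -tint_add; [|by apply: bm_add; exact: bt|exact: bt].
rewrite !(fun k => @IX_clip R d E k a b b w a0 (lexx b)) (mulrC (tint a b _)).
rewrite -!tint_scale; [|exact: bmt..].
have bs (z : R) k : bmeas E k -> bmfun (fun r : TR => z * X k (clip b r) w).
  by move=> bk; apply: bm_mul; [exact: bm_cst|exact: bmt].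
rewrite -!tint_add; [|by apply: bs|by apply: bs|by apply: bmt..].
rewrite -tint_sub; [|by apply: bm_add; exact: bmt|by apply: bm_add; exact: bs].
apply: eq_tint => r _.
(* At the cemetery every factor taken at time [r] from [A f], [A (H f)], [c] or [At f] is 0, so both
   sides vanish. *)
rewrite /X; case: (pval w (clip b r)) => [x|] /=; last by rewrite !(mul0r, mulr0, addr0, subr0).
rewrite /At /Gamma /c -/(H x).
have ex : expR (h x) != 0 by exact/lt0r_neq0/expR_gt0.
have -> : H x = expR (h x) - 1 by [].
move: (A f x) (A (H \* f) x) (A H x) (expR (h x)) (f x) (ext f _) (ext (H \* f) _) (ext H _) ex.
by move=> *; field.
Qed.

Lemma local_estimate (s t : R) (B : set (Defs.path E)) : 0 <= s -> s <= t -> Ft E s B ->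
  exists C : R, forall a b, s <= a -> a <= b -> b <= t ->
    `|expect Q (fun w => \1_B w * mp_process E At f b w) -
      expect Q (fun w => \1_B w * mp_process E At f a w)| <= C * (b - a) ^+ 2.
Proof.
move=> s0 st FB.
have bf : bmeas E f := C2c_bmeas E f2.
have bh : bmeas E h := C2c_bmeas E h2.
have bH : bmeas E H := C2c_bmeas E H2.
have HFc : C2c (H \* f) := HF2 f2.
have bHf : bmeas E (H \* f) := C2c_bmeas E HFc.
have btl : bmeas E (At f) := bmeas_tilted f2.
have [Mh Mh0 hM] := bmeas_bound bh.
have [Mc Mc0 cM] := bmeas_bound bc.
have [Mg Mg0 gM] := bmeas_bound btl.
have [Mf Mf0 fM] := bmeas_bound bf.
have [MHf MHf0 HfM] := bmeas_bound bHf.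
have [MH MH0 HM] := bmeas_bound bH.
have [Ma Ma0 aM] := bmeas_bound (bA f2).
have [MaHf MaHf0 aHfM] := bmeas_bound (bA HFc).
have [MaH MaH0 aHM] := bmeas_bound (bA H2).
(* [CY] bounds the common weight [Y], and [CR] the remainder [Rm] divided by [(b - a)^2]. In the
   total constant, three summands belong to the three frozen-factor integrals, each the product of
   the weight bound, the bound of the rough factor and the bound of the generator on the differenced
   function; the last belongs to [Rm]. *)
pose CY := expR Mh * expR (Mc * t).
pose CR := Mc ^+ 2 * expR (Mc * t) * (Mf + MHf) + Mc * expR (Mc * t) * ((1 + MH) * Mg).
exists (CY * Mc * Ma + CY * Mc * MaHf + CY * Mg * MaH + CY * CR) => a b sa ab bt.
have a0 := le_trans s0 sa; have b0 := le_trans a0 ab; have t0 := le_trans b0 bt.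
have aX k r u : bmeas E k -> 0 <= r -> r <= u -> adapted u (@X R d E k r).
  by move=> bk r0 ru; apply: adapted_X; rewrite ?r0.
have oX k r : bmeas E k -> 0 <= r -> bmO (@X R d E k r).
  by move=> bk r0; apply: (@adapted_bmO _ _ _ r); exact: aX.
have aI k : bmeas E k -> adapted b (@IX R d E k a b) by move=> bk; exact: adapted_IX.
have oI k : bmeas E k -> bmO (@IX R d E k a b) by move=> bk; exact: adapted_bmO (aI k bk).
have aB u : s <= u -> adapted u (\1_B : Defs.path E -> R).
  by move=> su; apply: adapted_le su _; exact: adapted_indic.
(* The part common to both densities and known at time [a]: on [B], [D a] is [Y e^(h(X_a))] and
   [D b] is [Y e^(h(X_b))] times the exponential of minus the integral of [c] over [[a, b]]. *)
pose Y (w : Defs.path E) := \1_B w * (expR (- X h 0 w) * expR (- IX c 0 a w)).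
have aY : adapted a Y.
  apply: (@bm_mul R _ (Ot E a)); first exact: aB.
  apply: (@bm_mul R _ (Ot E a)); apply: bm_expR; apply: bm_opp; first exact: aX.
  exact: adapted_IX.
have oY : bmO Y := adapted_bmO aY.
have YC w : `|Y w| <= CY.
  rewrite /Y normrM -[leRHS]mul1r ler_pM//.
    by rewrite indicE; case: (_ \in _); rewrite ?normr1 ?normr0.
  rewrite normrM /CY ler_pM// ger0_norm ?expR_ge0// ler_expR (le_trans (ler_norm _))// normrN.
    exact: X_le.
  apply: le_trans (IX_le closedE w bc cM Mc0 (lexx 0) a0) _.
  by rewrite subr0 ler_wpM2l// (le_trans ab).
pose del (w : Defs.path E) := IX c a b w.
pose F1 (w : Defs.path E) := X f b w + X (H \* f) b w.
pose I1 (w : Defs.path E) := (1 + X H b w) * IX (At f) a b w.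
(* [Rm] collects the second-order terms in the expansion of [exp (- del)]. *)
pose Rm (w : Defs.path E) := (expR (- del w) - 1 + del w) * F1 w - (expR (- del w) - 1) * I1 w.
have oF1 : bmO F1 by apply: bm_add; exact: oX.
have oI1 : bmO I1.
  by apply: bm_mul; [apply: bm_add; [exact: bm_cst|exact: oX]|exact: oI].
have oE : bmO (fun w => expR (- del w) - 1).
  by apply: bm_sub; [apply/bm_expR/bm_opp/oI|exact: bm_cst].
have oRm : bmO Rm.
  by apply: bm_sub; apply: bm_mul => //; apply: bm_add => //; exact: oI.
have RmC w : `|Rm w| <= CR * (b - a) ^+ 2.
  have ba0 : 0 <= b - a by rewrite subr_ge0.
  have dl : `|del w| <= Mc * (b - a) by exact: IX_le.
  have dt : expR `|- del w| <= expR (Mc * t).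
    by rewrite normrN ler_expR (le_trans dl)// ler_wpM2l//; lra.
  rewrite /CR mulrDl; apply: (le_trans (ler_normB _ _)); apply: lerD.
    have -> : Mc ^+ 2 * expR (Mc * t) * (Mf + MHf) * (b - a) ^+ 2 =
      (Mc * (b - a)) ^+ 2 * expR (Mc * t) * (Mf + MHf) by ring.
    rewrite normrM ler_pM//; last first.
      by apply: (le_trans (ler_normD _ _)); apply: lerD; exact: X_le.
    have := expR_sub1x_le (- del w); rewrite opprK => /le_trans; apply.
    by rewrite ler_pM ?expR_ge0// normrN lerXn2r// nnegrE mulr_ge0.
  have -> : Mc * expR (Mc * t) * ((1 + MH) * Mg) * (b - a) ^+ 2 =
      (Mc * (b - a) * expR (Mc * t)) * ((1 + MH) * (Mg * (b - a))) by ring.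
  rewrite normrM ler_pM//.
    apply: (le_trans (expR_sub1_le _)); rewrite ler_pM ?expR_ge0// normrN//.
  rewrite normrM ler_pM//; last exact: IX_le.
  by apply: (le_trans (ler_normD _ _)); rewrite normr1 lerD2l; exact: X_le.
have amp r : 0 <= r -> adapted r (mp_process E At f r) by move=> r0; exact: adapted_mp.
have omp r : 0 <= r -> bmO (mp_process E At f r) by move=> r0; exact: adapted_bmO (amp r r0).
have oB : bmO (\1_B : Defs.path E -> R) := adapted_bmO (aB s (lexx s)).
have aL : adapted b (fun w => \1_B w * (X f b w - IX (At f) a b w)).
  apply: (@bm_mul R _ (Ot E b)); first by apply: aB; exact: le_trans ab.
  by apply: (@bm_sub R _ (Ot E b)); [exact: aX|exact: aI].
have aS : adapted a (fun w => \1_B w * X f a w).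
  by apply: (@bm_mul R _ (Ot E a)); [exact: aB|exact: aX].
rewrite -expect_sub; [|exact: bm_mul (omp b b0)|exact: bm_mul (omp a a0)].
(* Under [Q] the initial value and the integral up to [a] cancel. What remains is one term known at
   [b] and one known at [a], so that each is transferred to [P] with the density of its own time. *)
rewrite (_ : (fun w => _) = (fun w => \1_B w * (X f b w - IX (At f) a b w) - \1_B w * X f a w));
  last first.
  by apply/funext => w; rewrite !mp_processE (@IX_split _ _ _ closedE (At f) 0 a b)//; ring.
rewrite (expect_sub _ (adapted_bmO aL) (adapted_bmO aS)) (expect_change b0 aL)
  (expect_change a0 aS).
have oD r : 0 <= r -> bmO (D r) by move=> r0; exact: adapted_bmO (adapted_density r0).
rewrite -expect_sub; [|exact: bm_mul (adapted_bmO aL) (oD b b0)|exact: bm_mul (adapted_bmO aS)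
  (oD a a0)].
pose T1 (w : Defs.path E) := Y w * (X f b w - X f a w).
pose T2 (w : Defs.path E) := Y w * (X (H \* f) b w - X (H \* f) a w).
pose S (w : Defs.path E) := Y w * (del w * F1 w + I1 w).
pose U (w : Defs.path E) := Y w * Rm w.
have oT1 : bmO T1 by apply: bm_mul => //; apply: bm_sub; exact: oX.
have oT2 : bmO T2 by apply: bm_mul => //; apply: bm_sub; exact: oX.
have oS : bmO S.
  by apply: bm_mul => //; apply: bm_add => //; apply: bm_mul => //; exact: oI.
have oU : bmO U by exact: bm_mul.
(* With [e^h = 1 + H], the difference is [Y] times [e^(- del) (F1 - I1)] minus the value of
   [f + H f] at [a]. [T1] and [T2] are the increments of [f] and [H f], [S] is the first-order term
   in [del] and [I1], and [U] is the rest. *)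
rewrite (_ : (fun w => _) = (fun w => T1 w + T2 w - S w + U w)); last first.
  apply/funext => w; rewrite !densityE /T1 /T2 /S /U /Rm /F1 /I1 /Y.
  rewrite (@IX_split _ _ _ closedE c 0 a b)// -/(del w) opprD !expRD.
  have XH r : X H r w = expR (X h r w) - 1.
    by rewrite /X; case: (pval w r) => [x|] //=; rewrite expR0 subrr.
  have XHf r : X (H \* f) r w = (expR (X h r w) - 1) * X f r w.
    by rewrite /X; case: (pval w r) => [x|] //=; rewrite mulr0.
  rewrite !XH !XHf.
  move: (expR (- del w)) (expR (X h b w)) (expR (X h a w)) (expR (- X h 0 w)) (expR (- IX c 0 a w)).
  by move: (del w) (IX (At f) a b w) (X f a w) (X f b w) (\1_B w) => *; ring.
have oT12 : bmO (fun w => T1 w + T2 w) by exact: bm_add.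
rewrite (expect_add _ (bm_sub oT12 oS) oU) (expect_sub _ oT12 oS) (expect_add _ oT1 oT2).
(* Under [P] the increments [T1] and [T2] become integrals of [A f] and [A (H f)], which match [S]
   to first order; [increment_identity] then gives the second-order difference. *)
rewrite (mart_increment closedE bA solP f2 a0 ab aY) (mart_increment closedE bA solP HFc a0 ab aY).
have oJ1 : bmO (fun w => Y w * IX (A f) a b w) by apply: bm_mul => //; exact/oI/bA.
have oJ2 : bmO (fun w => Y w * IX (A (H \* f)) a b w) by apply: bm_mul => //; exact/oI/bA.
rewrite -(expect_add _ oJ1 oJ2) -(expect_sub _ (bm_add oJ1 oJ2) oS).
have bK k g : bmeas E k -> bmeas E g ->
    bmO (fun w => Y w * tint a b (fun r => X k r w * (X g r w - X g b w))).
  move=> bk bg; apply: bm_mul => //.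
  rewrite (_ : (fun w => _) = (fun w => tint a b
      (fun r => X k (clip b r) w * (X g (clip b r) w - X g b w)))); last first.
    by apply/funext => w; apply: eq_tint => r /andP[ar rb]; rewrite clip_id// (le_trans a0 ar).
  apply: (@bm_tint R _ (Omega E) (fun p : TR * Omega E =>
     X k (clip b p.1) p.2 * (X g (clip b p.1) p.2 - X g b p.2))) => //.
  apply: bm_mul; first exact: bm_joint_Omega.
  apply: bm_sub; first exact: bm_joint_Omega.
  by apply: (@bm_comp R _ _ (Omega E) _ (X g b)) measurable_snd; exact: oX.
rewrite (_ : (fun w => Y w * IX (A f) a b w + _ - S w) = (fun w =>
   Y w * tint a b (fun r => X c r w * (X f r w - X f b w)) +
   Y w * tint a b (fun r => X c r w * (X (H \* f) r w - X (H \* f) b w)) +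
   Y w * tint a b (fun r => X (At f) r w * (X H r w - X H b w)))); last first.
  by apply/funext => w; rewrite -!mulrDr -increment_identity// /S mulrBr mulrDr.
have k1 := bK c f bc bf; have k2 := bK c (H \* f) bc bHf; have k3 := bK (At f) H btl bH.
rewrite (expect_add _ (bm_add k1 k2) k3) (expect_add _ k1 k2) !mulrDl.
apply: (le_trans (ler_normD _ _)); apply: lerD.
  apply: (le_trans (ler_normD _ _)); apply: lerD.
    apply: (le_trans (ler_normD _ _)); apply: lerD;
      by apply: (integrated_increment_le closedE bA solP).
  exact: (integrated_increment_le closedE bA solP).
apply: expect_norm_le => // w; rewrite /U normrM -mulrA ler_pM//.
Qed.

Lemma tilted_martingale : martingale E Q (mp_process E At f).
Proof.
have btl : bmeas E (At f) := bmeas_tilted f2.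
have amp r : 0 <= r -> adapted r (mp_process E At f r) by move=> r0; exact: adapted_mp.
have omp r : 0 <= r -> bmO (mp_process E At f r) by move=> r0; exact: adapted_bmO (amp r r0).
split=> [t t0|s t /andP[s0 st] B FB].
  split; last exact: (prob_integrable Q (omp t t0)).
  move=> B mB; have [mM _] := amp t t0.
  by have := mM measurableT B mB; rewrite setTI.
(* [C] depends on [s], [t] and [B] but not on the subinterval, as the partition argument
   requires. *)
have [C HC] := local_estimate s0 st FB.
have := eq_of_quadratic_increments st HC.
have oB : bmO (\1_B : Defs.path E -> R) := adapted_bmO (adapted_indic FB).
have t0 := le_trans s0 st.
have key r : 0 <= r -> (\int[Q]_(w in B) (mp_process E At f r w)%:E)%E =
    (expect Q (fun w => \1_B w * mp_process E At f r w))%:E.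
  move=> r0; rewrite expect_EFin; last exact: bm_mul (omp r r0).
  rewrite integral_mkcond; apply: eq_integral => w _; rewrite /patch indicE.
  by case: ifP => _; rewrite ?mul1r ?mul0r.
by move=> phi_ts; rewrite (key t t0) (key s s0) phi_ts.
Qed.

End One_function.
End Change_of_measure.

Unset Implicit Arguments.

Theorem theorem5p1 (R : realType) (d : nat) (E : set 'rV[R]_d)
    (alpha : 'rV[R]_d -> 'M[R]_d) (beta : 'rV[R]_d -> 'rV[R]_d)
    (gamma : 'rV[R]_d -> R) (mu : 'rV[R]_d -> {measure set Rd R d -> \bar R})
    (chi : 'rV[R]_d -> 'rV[R]_d)
    (P Q : probability (Omega E) R) (h : 'rV[R]_d -> R) :
  levy_data E alpha beta gamma mu chi ->
  (forall f, C2c f -> bmeas E (Aop alpha beta gamma mu chi f)) ->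
  solves_mp E P (Aop alpha beta gamma mu chi) ->
  C2c h ->
  let A := Aop alpha beta gamma mu chi in
  let H := fun x => expR (h x) - 1 in
  let D := fun (t : R) (w : Omega E) =>
    expR (ext h (pval w t) - ext h (pval w 0)) *
    expR (- Rintegral (@lebesgue_measure R) `[0, t]
              (fun s => ext (A H) (pval w s) / expR (ext h (pval w s)))) in
  (forall t, 0 <= t -> forall B : set (Omega E), Ftplus E t B ->
     Q B = (\int[P]_(w in B) (D t w)%:E)%E) ->
  let At := fun f x => A f x + Gamma A H f x / expR (h x) in
  [/\ (forall f, C2c f -> bmeas E (At f)),
      solves_mp E Q At
    & (forall f, C2c f -> forall x, E x ->
        At f x =
          2^-1 * (\sum_i \sum_j alpha x i j * pd i (pd j f) x)
          + \sum_i (beta x 0 i + \sum_j alpha x i j * pd j h x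
                    + Rintegral (mu x) setT
                        (fun xi : Rd R d => (expR (h (x + (xi : 'rV[R]_d)) - h x) - 1)
                                             * chi xi 0 i))
                   * pd i f x
          - expR (- h x) * gamma x * f x
          + Rintegral (mu x) setT
              (fun xi : Rd R d =>
                 (f (x + (xi : 'rV[R]_d)) - f x - \sum_i pd i f x * chi xi 0 i)
                 * expR (h (x + (xi : 'rV[R]_d)) - h x)))].
Proof.
move=> data bA solP h2 A H D HQ At.
have closedE : closed E by case: data.
split=> f f2.
- exact: (bmeas_tilted bA h2 f2).
- exact: (tilted_martingale closedE bA solP h2 HQ f2).
- by move=> x Ex; exact: (tilted_generatorE data f2 h2 Ex).
Qed.
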